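(* Let $n=1$ and $\beta=-1$, let $c>0$, and let $h(x)=\Gamma(-\frac{\beta}{2})(c^{2}+|x|^{2})^{\beta/2}=\Gamma(\tfrac12)(c^2+x^2)^{-1/2}$ for $x\in\mathbb{R}$. Let $\rho=1$ and $\Delta_0=1$. Let $b_0>0$ and put $$C=\max\left\{\frac{2}{3b_0},\frac{8\rho}{c}\right\},\qquad \delta_0=\frac{1}{3C},\qquad \lambda'=\left(\frac23\right)^{\frac{1}{3C}} .$$ Let $\sigma>0$ and $f\in B_\sigma$. Let $Q\subset\mathbb{R}$ be a $1$-simplex (closed line segment) of length $r$ with $\frac{1}{3C}\le r\le \frac{2}{3C}$, let $0<\delta\le\delta_0$, let $l$ be an integer with $\frac{1}{3C\delta}\le l\le\frac{2}{3C\delta}$, let $x_1,\dots,x_N$ be the evenly spaced points of degree $l$ in $Q$, and let $s$ be the $h$-interpolant of $f$ at $x_1,\dots,x_N$ (as defined in the context). Then for all $x\in Q$, $$|f(x)-s(x)|\le 2^{-2+\frac{-3n+\beta}{4}}\,\pi^{\frac{-3n-1}{4}}\sqrt{n\alpha_n}\,\sqrt{\Delta_0}\,\sqrt{3C}\;c^{\frac{\beta}{2}}\,\sqrt{\delta}\,(\lambda')^{\frac1\delta}\,\{A+B\}^{1/2},$$ where $\alpha_n$ is the volume of the unit ball in $\mathbb{R}^n$ (so $\alpha_1=2$), $$A=\frac{1}{\mathcal{K}_0(1)}\int_{|\xi|\le\frac1c}|\hat f(\xi)|^2\,d\xi,$$ and $$B=2\sqrt3\int_{\frac1c<|\xi|\le\sigma}|\hat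 f(\xi)|^2\sqrt{c|\xi|}\,e^{c|\xi|}\,d\xi\ \text{ if } \tfrac1c<\sigma,\qquad B=0\ \text{ if } \tfrac1c\ge\sigma .$$
   Context: **Special functions.** $\Gamma$ is the classical gamma function and $\mathcal{K}_0$ is the modified Bessel function of the second kind of order $0$. **Fourier transform and band-limited functions.** $\hat f$ is the Fourier transform on $L^2(\mathbb{R})$, normalized so that $\|\hat f\|_{L^2}=\|f\|_{L^2}$, i.e. $\hat f(\xi)=(2\pi)^{-1/2}\int f(x)e^{-ix\xi}\,dx$. $B_\sigma=\{f\in L^2(\mathbb{R}): \hat f(\xi)=0 \text{ if } |\xi|>\sigma\}$. Each $f\in B_\sigma$ is identified with its continuous representative. **Evenly spaced points.** If $Q$ is the segment with endpoints $v_1,v_2$, the evenly spaced points of degree $l$ in $Q$ are the $N=l+1$ points $\frac{k}{l}v_1+\frac{l-k}{l}v_2$, $k=0,1,\dots,l$. **Interpolant.** Here $m=\max\{0,\lceil\beta/2\rceil\}=0$, so no polynomial part occurs: the $h$-interpolant of $f$ at $x_1,\dots,x_N$ is the unique function $s(x)=\sum_{j=1}^N c_j h(x-x_j)$ with constants $c_j$ satisfying $\sum_{j=1}^N c_j h(x_i-x_j)=f(x_i)$ for $i=1,\dots,N$. **Constants.** $\rho=1$ and $\Delta_0=1$ are the values the paper's general definition of these constants takes for $n=1$, $\beta=-1$. *)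

(* Defs.v *)
From HB Require Import structures.
From mathcomp Require Export all_boot all_order all_algebra.
From mathcomp Require Export all_classical all_reals all_analysis.
From mathcomp Require Export complex.

Set Implicit Arguments.
Unset Strict Implicit.
Unset Printing Implicit Defensive.

Export Order.TTheory GRing.Theory Num.Theory.
Export numFieldNormedType.Exports.
Export ComplexField.Normc.

Local Open Scope classical_set_scope.
Local Open Scope ring_scope.

(* Euler's integral; meaningful for 0 < z only. *)
Definition Gamma (R : realType) (z : R) : R :=
  \int[lebesgue_measure]_(t in `]0, +oo[) (t `^ (z - 1) * expR (- t)).

Definition cosh (R : realType) (t : R) : R := (expR t + expR (- t)) / 2.

(* Modified Bessel function of the second kind,
   K_nu(z) = \int_0^oo e^(- z cosh t) cosh(nu t) dt; meaningful for 0 < z only. *)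
Definition besselK (R : realType) (nu z : R) : R :=
  \int[lebesgue_measure]_(t in `[0, +oo[)
    (expR (- (z * cosh t)) * cosh (nu * t)).

(* The volume alpha_1 of the unit ball of the real line. *)
Definition unit_ball_volume1 (R : realType) : R :=
  fine (lebesgue_measure [set x : R | `|x| <= 1]).

Section fourier.
Local Open Scope complex_scope.
Variable R : realType.
Local Notation mu := (@lebesgue_measure R).

Definition expi (t : R) : R[i] := cos t +i* sin t.

Definition cintegral (D : set R) (g : R -> R[i]) : R[i] :=
  (\int[mu]_(x in D) complex.Re (g x)) +i* (\int[mu]_(x in D) complex.Im (g x)).

Definition cmeasurable (g : R -> R[i]) : Prop :=
  measurable_fun setT (fun x => complex.Re (g x)) /\
  measurable_fun setT (fun x => complex.Im (g x)).

Definition sqnormL2 (g : R -> R[i]) : \bar R :=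
  (\int[mu]_x ((normc (g x)) ^+ 2)%:E)%E.

Definition inL2 (g : R -> R[i]) : Prop :=
  cmeasurable g /\ (sqnormL2 g < +oo)%E.

Definition truncated_fourier (T : R) (f : R -> R[i]) (xi : R) : R[i] :=
  ((Num.sqrt (2 * pi))^-1)%:C *
  cintegral `[- T, T] (fun x => f x * expi (- (x * xi))).

(* The L^2 (Plancherel) Fourier transform of f is only defined up to a null set:
   [is_fourier f g] says that g is a representative of it, namely of the L^2
   limit of the Fourier integrals of f restricted to [-T, T]. *)
Definition is_fourier (f g : R -> R[i]) : Prop :=
  [/\ inL2 f, inL2 g &
      sqnormL2 (fun xi => g xi - truncated_fourier T f xi)
        @[T --> +oo] --> 0%E].

(* Elements of B_sigma, given by their continuous representatives. *)
Definition bandlimited (sigma : R) : set (R -> R[i]) :=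
  [set f | continuous (f : R -> R[i]^o) /\
    exists2 g, is_fourier f g &
      {ae mu, forall xi, sigma < `|xi| -> g xi = 0}].

End fourier.

(* h(x) = Gamma(-beta/2) (c^2 + |x|^2)^(beta/2) on the real line. *)
Definition multiquadric (R : realType) (beta c x : R) : R :=
  Gamma (- beta / 2) * (c ^+ 2 + `|x| ^+ 2) `^ (beta / 2).

Definition segment (R : realType) (v1 v2 : R) : set R :=
  [set t * v1 + (1 - t) * v2 | t in `[0, 1]].

Definition evenly_spaced (R : realType) (v1 v2 : R) (l : nat) (k : 'I_l.+1) : R :=
  k%:R / l%:R * v1 + (l%:R - k%:R) / l%:R * v2.

(* No polynomial part, as max {0, ceil(beta/2)} = 0 for beta < 0. *)
Definition is_interpolant (R : realType) (h : R -> R) (N : nat) (x : 'I_N -> R)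
    (f s : R -> R[i]) : Prop :=
  exists2 a : 'I_N -> R[i],
    forall t, s t = \sum_(j < N) a j * (h (t - x j))%:C%C &
    forall i, s (x i) = f (x i).

(* Main.v *)
Require Import Defs.
From mathcomp Require Import ring lra measurable_realfun qpoly.

(** Up to a constant factor, which the coefficients of the interpolant absorb,
the kernel is [k y = pi / sqrt (c^2 + y^2)], and [k] is the Fourier transform of
the positive function [w xi = K_0 (c |xi|)].  It is therefore positive
semidefinite, and a band-limited [f] belongs to its native space, with squared
norm [N = (2 pi)^-1 \int |fhat|^2 / w].  The [k]-interpolant is the orthogonal
projection of [f] onto the span of the translates of [k] to the nodes, so that
[|f x - s x|^2 <= N * P], where [P] is the value of the quadratic form of [k] on
[delta_x - \sum_j gamma_j delta_(x_j)], for any weights [gamma].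

The two factors are estimated separately.

- For [N]: [K_0] is nonincreasing, whence [1 / w <= 1 / K_0 1] for
  [|xi| <= 1 / c]; for [z = c |xi| >= 1] an elementary lower bound gives
  [1 / K_0 z <= 3 sqrt z e^z <= 2 sqrt 3 sqrt z e^z].  Hence
  [2 pi N <= A + B] ([integral_spectral_weight_le]).
- For [P]: with the Lagrange weights at the [l + 1] nodes, Rolle's theorem
  bounds the error for [y |-> e^(i y xi)] by [(r |xi|)^(l+1) / (l+1)!]
  ([lagrange_exp_error]). The moment of order [2 n] of [K_0 (c |xi|)] is at most
  [4 (2 n)! / c^(2 n + 1)], and [C >= 8 / c] forces [r <= c / 12], which yields
  [P <= (4 / c) / 36^(l+1)] ([power_function_le], [power_function_numeric]).
  This is far below the square of the asserted constant, because
  [l >= 1 / (3 C delta)] ([decay_numeric]).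

The native space enters through a single inequality, namely
[2 \sum_m p_m u (y_m) <= N + \sum_(m, n) p_m p_n k (y_m - y_n)] for finite
real families ([native_duality]), which integrates the pointwise inequality
[2 a b <= W a^2 + w b^2], valid for any [W > 0] with [W w >= 1]; so [1 / w] may
be replaced in [N] by the explicit upper bound just found.  Taking for [p] the
coefficients of the interpolant plus [t] times the functional above, the
conditions [s (x_j) = f (x_j)] cancel the cross terms, and letting [t] vary
gives the error estimate ([native_interpolation_error]).  Since the kernel is
real, multiplying everything by a phase makes the error [f x - s x] real, and
only the real function [u = Re (e^(- i th) f)] and real coefficients are needed.

What remains is the formula [f y = (2 pi)^(-1/2) \int fhat xi e^(i y xi)] at
every point [y] ([fourier_inversion]), while [fhat] is known only as an [L^2]
limit of truncated transforms.  Both sides are tested against [e^(- e |xi|)]: on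
the side of [f] this produces the Poisson kernel, an approximate identity to
which the continuity of [f] applies; on the side of [fhat] the band limit makes
the factor converge uniformly to [1].  All complex integrals are written with
sines and cosines, the phase [th] selecting the real part under study. *)

Set Implicit Arguments.
Unset Strict Implicit.
Unset Printing Implicit Defensive.

Local Open Scope classical_set_scope.
Local Open Scope ring_scope.

(** * Exponential integrals over the half-line and the line *)

Section halfline.
Variable R : realType.
Notation mu := (@lebesgue_measure R).

Lemma continuous_derive (F f : R -> R) :
  (forall x : R, is_derive x 1 F (f x)) -> continuous F.
Proof.
move=> dF x; apply: differentiable_continuous.
by apply/derivable1_diffP; have [] := dF x.
Qed.

Lemma ge0_FTC2y_derive (f F : R -> R) (l : R) :
  (forall x, 0 <= x -> 0 <= f x) -> continuous f ->
  (forall x : R, is_derive x 1 F (f x)) -> F x @[x --> +oo] --> l ->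
  (\int[mu]_(x in `[0%R, +oo[) (f x)%:E = (l - F 0)%:E)%E.
Proof.
move=> f0 cf dF Fl; rewrite EFinB.
apply: (@ge0_continuous_FTC2y R f F 0 l) => //.
- exact: continuous_subspaceT.
- by apply: cvg_at_right_filter; exact: (continuous_derive dF).
- by move=> x _; rewrite derive1E; have [_] := dF x.
Qed.

(** Evenness of Lebesgue measure reduces every integral over the line to the
half-line, where an antiderivative and its limit at infinity suffice. *)
Lemma ge0_integral_halflines (g : R -> R) :
  measurable_fun setT g -> (forall x, 0 <= g x) ->
  (\int[mu]_x (g x)%:E =
   \int[mu]_(x in `[0%R, +oo[) (g x)%:E +
     \int[mu]_(x in `[0%R, +oo[) (g (- x))%:E)%E.
Proof.
move=> mg g0.
have mgN : measurable_fun setT (fun x : R => (g (- x))%:E).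
  apply/measurable_EFinP; apply: measurableT_comp => //; exact: measurable_funN.
rewrite (@ge0_integration_by_substitution0 R (fun x : R => (g (- x))%:E))//;
  last by move=> r; rewrite lee_fin.
under [X in (_ + X)%E]eq_integral do rewrite opprK.
have -> : [set: R] = `[0, +oo[ `|` `]-oo, 0[.
  apply/seteqP; split => // x _ /=; rewrite !in_itv/= andbT.
  by case: (leP 0 x) => _; [left|right].
rewrite ge0_integral_setU//=.
- congr (_ + _)%E; rewrite integral_itv_bndo_bndc//.
  by apply/measurable_EFinP; exact: measurable_funTS.
- by apply/measurable_EFinP; exact: measurable_funTS.
- by move=> x _; rewrite lee_fin.
- apply/disj_setPLR => x /=; rewrite !in_itv/= andbT => x0.
  by rewrite ltNge x0.
Qed.

Lemma cvgy_expR_scale (e : R) : 0 < e -> expR (- (e * x)) @[x --> +oo] --> 0.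
Proof.
move=> e0.
have H := @cvgr_expR R.
apply: (@cvg_comp _ _ _ (fun x => e * x) (fun x => expR (- x)) _ +oo _ _ H).
by apply: gt0_cvgMry => //; exact: cvg_id.
Qed.

Lemma cvgy_expR_bounded (e K : R) (g : R -> R) : 0 < e ->
  (forall x, 0 <= x -> `|g x| <= K) ->
    expR (- (e * x)) * g x @[x --> +oo] --> 0.
Proof.
move=> e0 gK; apply/cvgr0Pnorm_le => d d0.
have K0 : 0 <= K by apply: le_trans (gK 0 _).
have dK : 0 < d / (K + 1) by rewrite divr_gt0// ltr_pwDr.
have /cvgr0Pnorm_le/(_ _ dK) := cvgy_expR_scale e0.
apply: filterS2 (nbhs_pinfty_ge (num_real 0)) => x x0; rewrite normrM => h.
apply: le_trans (ler_pM _ _ h (gK x x0)) _ => //.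
rewrite -mulrA ler_piMr ?(ltW d0)// mulrC ler_pdivrMr ?mul1r ?ltr_pwDr//.
by rewrite lerDl.
Qed.

Lemma measurable_cos_affine (a th : R) :
  measurable_fun setT (fun x : R => cos (a * x - th)).
Proof.
apply: continuous_measurable_fun => x.
apply: continuous_comp; last exact: continuous_cos.
by apply: cvgB; [apply: cvgM; [exact: cvg_cst|exact: cvg_id]|exact: cvg_cst].
Qed.

Lemma measurable_sin_affine (a th : R) :
  measurable_fun setT (fun x : R => sin (a * x - th)).
Proof.
apply: continuous_measurable_fun => x.
apply: continuous_comp; last exact: continuous_sin.
by apply: cvgB; [apply: cvgM; [exact: cvg_cst|exact: cvg_id]|exact: cvg_cst].
Qed.

Lemma measurable_expabs (e : R) :
  measurable_fun setT (fun x : R => expR (- (e * `|x|))).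
Proof.
by apply: measurableT_comp => //; apply: measurable_funN;
  apply: measurable_funM => //.
Qed.

Lemma onePcos_ge0 (x : R) : 0 <= 1 + cos x.
Proof. by have := cos_geN1 x; lra. Qed.

(** Adding [1] to the cosine makes the integrand nonnegative, so that the
fundamental theorem on a half-line applies to it, and later Tonelli's theorem;
the contribution of [1] is subtracted afterwards. *)
Lemma integral_expR_onePcos (e a th : R) : 0 < e ->
  (\int[mu]_(x in `[0%R, +oo[) (expR (- (e * x)) * (1 + cos (a * x - th)))%:E =
   (e^-1 + (e * cos th + a * sin th) / (e ^+ 2 + a ^+ 2))%:E)%E.
Proof.
move=> e0.
have ea0 : e ^+ 2 + a ^+ 2 != 0.
  by rewrite gt_eqF// ltr_pwDl ?sqr_ge0// exprn_gt0.
pose G (x : R) := - (e^-1 + (e * cos (a * x - th) - a * sin (a * x - th)) /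
  (e ^+ 2 + a ^+ 2)).
have dF (x : R) : is_derive x (1 : R) (fun x => expR (- (e * x)) * G x)
    (expR (- (e * x)) * (1 + cos (a * x - th))).
  rewrite /G; apply: is_derive_eq.
  rewrite /GRing.scale/=.
  field.
  by rewrite ea0 gt_eqF.
have FF : (fun x => expR (- (e * x)) * G x) x @[x --> +oo] --> (0 : R).
  apply: (@cvgy_expR_bounded _ (e^-1 + (e + `|a|) / (e ^+ 2 + a ^+ 2))) =>
    // x _.
  rewrite normrN; apply: le_trans (ler_normD _ _) _.
  rewrite gtr0_norm ?invr_gt0// lerD2l normrM normfV.
  rewrite [X in _ / X]gtr0_norm ?lt0r ?ea0 ?addr_ge0 ?sqr_ge0//.
  rewrite ler_pM2r ?invr_gt0 ?lt0r ?ea0 ?addr_ge0 ?sqr_ge0//.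
  apply: le_trans (ler_normB _ _) _; rewrite !normrM (gtr0_norm e0).
  by apply: lerD; apply: ler_piMr => //;
    rewrite ?(ltW e0)// ler_norml ?cos_geN1 ?cos_le1 ?sin_geN1 ?sin_le1.
rewrite (ge0_FTC2y_derive _ _ dF FF).
- rewrite /G !mulr0 oppr0 expR0 !sub0r cosN sinN; congr (EFin _); ring.
- by move=> x _; rewrite mulr_ge0 ?expR_ge0 ?onePcos_ge0.
- by move=> x; apply: differentiable_continuous; apply/derivable1_diffP.
Qed.

(** The sine terms of the two half-lines cancel. *)
Lemma integral_expabs_onePcos (e a th : R) : 0 < e ->
  (\int[mu]_x (expR (- (e * `|x|)) * (1 + cos (a * x - th)))%:E =
   (2 / e + 2 * e * cos th / (e ^+ 2 + a ^+ 2))%:E)%E.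
Proof.
move=> e0; rewrite ge0_integral_halflines; first last.
- by move=> x; rewrite mulr_ge0 ?expR_ge0 ?onePcos_ge0.
- apply: measurable_funM; first exact: measurable_expabs.
  by apply: measurable_funD => //; exact: measurable_cos_affine.
rewrite (_ : 2 / e + _ =
  (e^-1 + (e * cos th + a * sin th) / (e ^+ 2 + a ^+ 2)) +
   (e^-1 + (e * cos th + (- a) * sin th) / (e ^+ 2 + (- a) ^+ 2))); last first.
  by rewrite sqrrN; ring.
rewrite EFinD -!integral_expR_onePcos//; congr (_ + _)%E.
- by apply: eq_integral => x; rewrite inE/= in_itv/= andbT => x0;
    rewrite ger0_norm.
- apply: eq_integral => x; rewrite inE/= in_itv/= andbT => x0.
  by rewrite normrN ger0_norm// mulrN mulNr.
Qed.

(** Half of the exponential absorbs the power, by [1 + z^n / n! <= e^z]. *)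
Lemma cvgy_expR_pow (e : R) n : 0 < e ->
  expR (- (e * x)) * x ^+ n @[x --> +oo] --> 0.
Proof.
move=> e0; have e20 : 0 < e / 2 by rewrite divr_gt0.
under eq_fun => x do rewrite {1}[e]splitr mulrDl opprD expRD -mulrA.
apply: (@cvgy_expR_bounded _ (1 + n`!%:R * (e / 2) ^- n)) => // x x0.
case: n => [|n].
  rewrite fact0 !expr0 invr1 !mulr1 ger0_norm ?expR_ge0//.
  rewrite (@le_trans _ _ 1)//; last by lra.
  by rewrite expR_le1 oppr_le0 mulr_ge0 // ltW.
have ex0 : 0 <= e / 2 * x by rewrite mulr_ge0 // ltW.
rewrite ger0_norm ?mulr_ge0 ?expR_ge0 ?exprn_ge0//
  expRN mulrC ler_pdivrMr ?expR_gt0//.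
have K0 : 0 <= (n.+1)`!%:R *
  (e / 2) ^- n.+1 by rewrite mulr_ge0 ?ler0n ?invr_ge0 ?exprn_ge0// ltW.
apply: (@le_trans _ _ ((n.+1)`!%:R * (e / 2) ^- n.+1 * expR (e / 2 * x)));
  last first.
  by rewrite ler_wpM2r ?expR_ge0// lerDr.
apply: le_trans (ler_wpM2l K0 (expR_ge1Dxn n ex0)).
(* the constant was chosen to recover [x ^+ n.+1] exactly *)
rewrite mulrDr mulr1 [X in _ + X](_ : _ = x ^+ n.+1); first by rewrite lerDr.
rewrite [(e / 2 * x) ^+ _]exprMn.
field.
by rewrite expf_neq0 ?gt_eqF//= pnatr_eq0 -lt0n fact_gt0.
Qed.

(** The polynomial [P] for which [- e^(- e x) P x / e] is an antiderivative of
[e^(- e x) x^n]: repeated integration by parts, packaged as a recursion. *)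
Fixpoint moment_poly (e : R) n : {poly R} :=
  if n is n'.+1 then 'X^n + (n%:R / e) *: moment_poly e n' else 1.

Lemma deriv_moment_poly (e : R) n : e != 0 ->
  e *: moment_poly e n - (moment_poly e n)^`() = e *: 'X^n.
Proof.
move=> e0; elim: n => [|n IH] /=; first by rewrite expr0 -polyC1 derivC subr0.
rewrite derivD derivXn derivZ scalerDr.
rewrite opprD addrACA scalerA [e * _]mulrC -scalerA -scalerBr IH scalerA
  divfK//.
by rewrite scaler_nat subrK.
Qed.

Lemma moment_poly0 (e : R) n : (moment_poly e n).[0] = n`!%:R / e ^+ n.
Proof.
elim: n => [|n IH] /=; first by rewrite hornerC fact0 expr0 divr1.
rewrite hornerD hornerXn expr0n/= add0r hornerZ IH factS natrM exprS invfM;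
  ring.
Qed.

Lemma cvgy_expR_moment_poly (e : R) n : 0 < e ->
  expR (- (e * x)) * (moment_poly e n).[x] @[x --> +oo] --> 0.
Proof.
move=> e0; elim: n => [|n IH] /=.
  under eq_fun do rewrite hornerC mulr1; exact: cvgy_expR_scale.
under eq_fun => x do rewrite hornerD hornerXn hornerZ mulrDr mulrCA.
rewrite -[0]addr0; apply: cvgD; first exact: cvgy_expR_pow.
by rewrite -[0](mulr0 (n.+1%:R / e)); apply: cvgM => //; exact: cvg_cst.
Qed.

Lemma integral_expR_pow (e : R) n : 0 < e ->
  (\int[mu]_(x in `[0%R, +oo[) (expR (- (e * x)) * x ^+ n)%:E =
   (n`!%:R / e ^+ n.+1)%:E)%E.
Proof.
move=> e0.
pose F (x : R) := - (e^-1 * (expR (- (e * x)) * (moment_poly e n).[x])).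
have dF (x : R) : is_derive x (1 : R) F (expR (- (e * x)) * x ^+ n).
  rewrite /F; apply: is_derive_eq.
  rewrite /GRing.scale/=.
  have := congr1 (fun p => p.[x]) (deriv_moment_poly n (lt0r_neq0 e0)).
  rewrite hornerD hornerN !hornerZ hornerXn => h.
  have -> : x ^+ n = e^-1 * (e * x ^+ n) by rewrite mulKf ?gt_eqF.
  rewrite -h; ring.
have F0 : F x @[x --> +oo] --> (0 : R).
  rewrite /F -[0]oppr0 -[0](mulr0 e^-1); apply: cvgN; apply: cvgM;
    first exact: cvg_cst.
  exact: cvgy_expR_moment_poly.
rewrite (ge0_FTC2y_derive _ _ dF F0).
- rewrite /F mulr0 oppr0 expR0 mul1r moment_poly0 exprS invfM; congr EFin; ring.
- by move=> x x0; rewrite mulr_ge0 ?expR_ge0 ?exprn_ge0.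
- move=> x; apply: cvgM; last exact: exprn_continuous.
  apply: continuous_comp; last exact: continuous_expR.
  by apply: cvgN; apply: cvgM; [exact: cvg_cst|exact: cvg_id].
Qed.

Lemma integral_expR_even_pow (e : R) n : 0 < e ->
  (\int[mu]_x (expR (- (e * `|x|)) * x ^+ n.*2)%:E =
   (2 * n.*2`!%:R / e ^+ n.*2.+1)%:E)%E.
Proof.
move=> e0; rewrite ge0_integral_halflines; first last.
- by move=> x; rewrite mulr_ge0 ?expR_ge0// -mul2n exprM exprn_ge0 ?sqr_ge0.
- apply: measurable_funM; first exact: measurable_expabs.
  by apply: continuous_measurable_fun; exact: exprn_continuous.
rewrite (_ : 2 * n.*2`!%:R / _ =
  n.*2`!%:R / e ^+ n.*2.+1 + n.*2`!%:R / e ^+ n.*2.+1); last first.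
  by ring.
rewrite EFinD -integral_expR_pow//; congr (_ + _)%E.
- by apply: eq_integral => x; rewrite inE/= in_itv/= andbT => x0;
    rewrite ger0_norm.
- apply: eq_integral => x; rewrite inE/= in_itv/= andbT => x0.
  by rewrite normrN ger0_norm// -mul2n !exprM sqrrN.
Qed.

End halfline.

(** * The Bessel function of order zero and its Fourier transform *)

Section bessel.
Variable R : realType.
Notation mu := (@lebesgue_measure R).

Lemma cosh_gt0 (t : R) : 0 < cosh t.
Proof. by rewrite /cosh divr_gt0// addr_gt0 ?expR_gt0. Qed.

Lemma cosh_ge_expR (t : R) : expR t / 2 <= cosh t.
Proof. by rewrite /cosh ler_pM2r ?invr_gt0// lerDl expR_ge0. Qed.

Lemma cosh_ge1 (t : R) : 1 <= cosh t.
Proof.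
rewrite /cosh expRN ler_pdivlMr// mul1r.
have e0 := expR_gt0 t; rewrite -subr_ge0.
have -> : expR t + (expR t)^-1 - 2 = (expR t - 1) ^+ 2 / expR t by field;
  rewrite gt_eqF.
by rewrite divr_ge0 ?sqr_ge0// ltW.
Qed.

Lemma cosh0 : cosh (0 : R) = 1.
Proof. by rewrite /cosh oppr0 expR0; field. Qed.

Lemma continuous_cosh : continuous (@cosh R).
Proof.
move=> x; apply: cvgM; last exact: cvg_cst.
apply: cvgD; first exact: continuous_expR.
by apply: continuous_comp; [exact: cvgN|exact: continuous_expR].
Qed.

Lemma measurable_cosh : measurable_fun setT (@cosh R).
Proof. exact: continuous_measurable_fun continuous_cosh. Qed.

Lemma besselK0E (z : R) :
  besselK 0 z = \int[mu]_(t in `[0, +oo[) expR (- (z * cosh t)).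
Proof. by apply: eq_Rintegral => t _; rewrite mul0r cosh0 mulr1. Qed.

Lemma measurable_expcosh (D : set R) (z : R) :
  measurable_fun D (fun t => expR (- (z * cosh t))).
Proof.
apply: measurable_funTS; apply: measurableT_comp => //.
by apply: measurable_funN; apply: measurable_funM => //; exact: measurable_cosh.
Qed.

Lemma integrable_expRN :
  mu.-integrable `[0, +oo[ (EFin \o (fun t : R => expR (- t))).
Proof.
apply/integrableP; split.
  apply/measurable_EFinP; apply: measurable_funTS;
    apply: measurableT_comp => //.
have -> : (\int[mu]_(t in `[0%R, +oo[) `|(EFin \o (fun t : R => expR (- t))) t|
   = \int[mu]_(t in `[0%R, +oo[) (expR (- (1 * t)) * t ^+ 0)%:E)%E.
  apply: eq_integral => t _;
    rewrite /= ger0_norm ?expR_ge0// mul1r expr0 mulr1//.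
by rewrite integral_expR_pow// ltry.
Qed.

(** [e^(- z cosh t) <= 1 / (z cosh t) <= (2 / z) e^(- t)]. *)
Lemma integrable_expcosh (z : R) : 0 < z ->
  mu.-integrable `[0, +oo[ (EFin \o (fun t : R => expR (- (z * cosh t)))).
Proof.
move=> z0.
have ig : mu.-integrable `[0, +oo[ (fun t =>
  (2 / z)%:E * (EFin \o (fun t : R => expR (- t))) t)%E.
  by apply: integrableZl => //; exact: integrable_expRN.
apply: (le_integrable _ _ _ ig) => //.
- by apply/measurable_EFinP; exact: measurable_expcosh.
- move=> t _ /=; rewrite lee_fin ger0_norm ?expR_ge0// ger0_norm; last first.
    by rewrite mulr_ge0 ?expR_ge0// divr_ge0// ltW.
  rewrite !expRN; set c := cosh t; have c0 : 0 < c := cosh_gt0 t.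
  have zc0 : 0 < z * c by rewrite mulr_gt0.
  apply: (@le_trans _ _ (z * c)^-1).
    by rewrite lef_pV2 ?posrE ?expR_gt0// (le_trans _ (expR_ge1Dx _))// lerDr.
  rewrite (_ : 2 / z / expR t = (z * (expR t / 2))^-1); last first.
    by field; rewrite !gt_eqF ?expR_gt0.
  have hh : 0 < expR t / 2 by rewrite divr_gt0 ?expR_gt0.
  by rewrite lef_pV2 ?posrE ?(mulr_gt0 z0)// ler_pM2l// cosh_ge_expR.
Qed.

Lemma besselK0_EFin (z : R) : 0 < z ->
  ((besselK 0 z)%:E = \int[mu]_(t in `[0%R, +oo[) (expR (- (z * cosh t)))%:E)%E.
Proof.
move=> z0; rewrite besselK0E /Rintegral fineK//.
by apply: integrable_fin_num => //; exact: integrable_expcosh.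
Qed.

Lemma besselK0_ge0 (z : R) : 0 <= besselK 0 z.
Proof. by rewrite besselK0E; apply: Rintegral_ge0 => t _; exact: expR_ge0. Qed.

Lemma besselK0_nonincreasing (z z' : R) : 0 < z -> z <= z' ->
  besselK 0 z' <= besselK 0 z.
Proof.
move=> z0 zz'; rewrite !besselK0E; apply: le_Rintegral => //.
- exact: integrable_expcosh (lt_le_trans z0 zz').
- exact: integrable_expcosh.
- by move=> t _; rewrite ler_expR lerN2 ler_pM2r ?cosh_gt0.
Qed.

(** From [1 + v <= e^v] at [v = u] and [v = - u] one gets
[cosh u <= 1 / (1 - u^2)]. *)
Lemma cosh_le_half (u : R) : 0 <= u <= 2^-1 -> cosh u <= 1 + 4 / 3 * u ^+ 2.
Proof.
move=> /andP[u0 u2].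
have h1 : expR u <= (1 - u)^-1.
  rewrite -[expR u]invrK -expRN lef_pV2 ?posrE ?expR_gt0//; last by lra.
  exact: expR_ge1Dx.
have h2 : expR (- u) <= (1 + u)^-1.
  by rewrite expRN lef_pV2 ?posrE ?expR_gt0 ?expR_ge1Dx//; lra.
rewrite /cosh; apply: (@le_trans _ _ (((1 - u)^-1 + (1 + u)^-1) / 2)).
  by rewrite ler_pM2r ?invr_gt0// lerD.
have -> : ((1 - u)^-1 + (1 + u)^-1) / 2 = (1 - u ^+ 2)^-1.
  by field; apply/and3P; split; rewrite gt_eqF//; nra.
have u22 : u ^+ 2 <= 1 / 4 by nra.
rewrite -div1r ler_pdivrMr; last by lra.
have : 0 <= u ^+ 2 by exact: sqr_ge0.
nra.
Qed.

(** On [0 <= t <= 1 / (2 sqrt z)] the exponent satisfies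
[z cosh t <= z + 1 / 3], and [e^(- 1 / 3) >= 2 / 3]; the length of this interval
times [2 / 3] is [1 / (3 sqrt z)]. *)
Lemma besselK0_ge_expR (z : R) : 1 <= z -> expR (- z) / (3 * Num.sqrt z) <=
  besselK 0 z.
Proof.
move=> z1; have z0 : 0 < z by apply: lt_le_trans z1.
set s := Num.sqrt z; have s0 : 0 < s by rewrite sqrtr_gt0.
have ss : s ^+ 2 = z by rewrite sqr_sqrtr// ltW.
have s1 : 1 <= s by rewrite -(@ler_pXn2r _ 2) ?nnegrE// ?ss ?expr1n// ltW.
rewrite besselK0E.
(* restricting the integral to [[0, a]] loses only a constant factor *)
pose a : R := (2 * s)^-1.
have a0 : 0 < a by rewrite invr_gt0 mulr_gt0.
have i2 : mu.-integrable `[0, a] (EFin \o (fun t : R => expR (- (z * cosh t)))).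
  apply: integrableS (integrable_expcosh z0) => //.
  by move=> t /=; rewrite !in_itv/= => /andP[->].
have : \int[mu]_(t in `[0, a]) (expR (- z) * (2 / 3)) <=
  \int[mu]_(t in `[0, a]) expR (- (z * cosh t)).
  apply: le_Rintegral => //.
    apply: continuous_compact_integrable; first exact: segment_compact.
    by apply: continuous_subspaceT => x; exact: cst_continuous.
  move=> t /=; rewrite in_itv/= => /andP[t0 ta].
  have ha : a <= 2^-1 by rewrite lef_pV2 ?posrE ?mulr_gt0// ler_peMr.
  have tt : cosh t <= 1 + 4 / 3 * t ^+ 2 by apply: cosh_le_half;
    rewrite t0 (le_trans ta).
  have t2 : z * t ^+ 2 <= 1 / 4.
    rewrite -ss -exprMn (_ : 1 / 4 = (1 / 2) ^+ 2); last by field.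
    rewrite ler_pXn2r ?nnegrE ?mulr_ge0 ?(ltW s0)//.
    rewrite (le_trans (ler_wpM2l (ltW s0) ta))// /a;
      have -> : s * (2 * s)^-1 = 1 / 2 by field; rewrite gt_eqF.
    by [].
  apply: (@le_trans _ _ (expR (- z) * expR (- (1 / 3)))).
    rewrite ler_pM2l ?expR_gt0//; apply: le_trans (expR_ge1Dx _); lra.
  rewrite -expRD ler_expR; nra.
have ma : mu `[0, a] =
  a%:E by rewrite lebesgue_measure_itv/= lte_fin a0 -EFinB subr0.
rewrite Rintegral_cst//= => h; move: h; rewrite [X in fine X]ma /= => h.
have e1 : expR (- z) / (3 * s) = expR (- z) * (2 / 3) * a by rewrite /a; field;
  rewrite gt_eqF.
rewrite e1; apply: (le_trans h); rewrite /Rintegral fine_le//.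
- exact: integrable_fin_num.
- by apply: integrable_fin_num => //; exact: integrable_expcosh.
apply: ge0_subset_integral => //.
- by apply/measurable_EFinP; exact: measurable_expcosh.
- by move=> t /=; rewrite !in_itv/= => /andP[->].
Qed.

Lemma besselK0_gt0 (z : R) : 0 < z -> 0 < besselK 0 z.
Proof.
move=> z0; apply: (@lt_le_trans _ _ (besselK 0 (z + 1))).
  apply: lt_le_trans (besselK0_ge_expR _); last by rewrite lerDr ltW.
  by rewrite divr_gt0 ?expR_gt0// mulr_gt0// sqrtr_gt0 addr_gt0.
by apply: besselK0_nonincreasing => //; rewrite lerDl.
Qed.

(** The indicator turns the half-line integral defining [K_0] into an integral
over the whole line, as the product-measure theorems require. *)
Definition bessel_integrand (c : R) (p : R -> R) (z : R * R) : \bar R :=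
  (p z.1 * (expR (- (c * cosh z.2 * `|z.1|)) * \1_(`[0, +oo[ : set R) z.2))%:E.

Lemma measurable_bessel_integrand c p : measurable_fun setT p ->
  measurable_fun setT (bessel_integrand c p).
Proof.
move=> mp; apply/measurable_EFinP; apply: measurable_funM.
  by apply: measurableT_comp => //; exact: measurable_fst.
apply: measurable_funM.
  apply: measurableT_comp => //; apply: measurable_funN; apply: measurable_funM.
    apply: measurable_funM => //; apply: measurableT_comp;
      [exact: measurable_cosh|exact: measurable_snd].
  by apply: measurableT_comp => //; exact: measurable_fst.
by apply: measurableT_comp => //; exact: measurable_snd.
Qed.

Lemma bessel_integrand_ge0 c p z : (forall x, 0 <= p x) ->
  (0 <= bessel_integrand c p z)%E.
Proof. by move=> p0; rewrite lee_fin !mulr_ge0 ?expR_ge0. Qed.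

Lemma bessel_integrand_section1 c p x : x != 0 -> 0 < c ->
  (\int[mu]_t bessel_integrand c p (x, t) = (besselK 0 (c * `|x|) * p x)%:E)%E.
Proof.
move=> x0 c0; have cx : 0 < c * `|x| by rewrite mulr_gt0// normr_gt0.
rewrite mulrC EFinM besselK0_EFin// -integralZl//;
  last exact: integrable_expcosh.
rewrite [RHS]integral_mkcond; apply: eq_integral => t _.
rewrite patchE /bessel_integrand/= indicE; case: ifPn => _; rewrite ?mulr0//.
by rewrite mulr1 -EFinM; congr (_ * expR (- _))%:E; ring.
Qed.

Lemma bessel_integrand_section2 c p t :
  (\int[mu]_x bessel_integrand c p (x, t) =
    if t \in (`[0%R, +oo[%classic : set R) then \int[mu]_x
    (expR (- (c * cosh t * `|x|)) * p x)%:E else 0)%E.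
Proof.
case: ifPn => t0.
  by apply: eq_integral => x _;
    rewrite /bessel_integrand/= indicE t0 mulr1 mulrC.
by rewrite integral0_eq// => x _;
  rewrite /bessel_integrand/= indicE (negbTE t0) !mulr0.
Qed.

(** At [0] the integral diverges and the real-valued [K_0] has the default
value of [fine]; the point is treated apart. *)
Lemma measurable_besselK0 (c : R) : 0 < c ->
  measurable_fun setT (fun x : R => besselK 0 (c * `|x|)).
Proof.
move=> c0; have m1 :
  measurable_fun setT (cst (1 : R) : R -> R) by exact: measurable_cst.
have mm := measurable_bessel_integrand c m1.
have := measurable_fun_fubini_tonelli_F (m2 :=
  mu) _ mm (fun z => bessel_integrand_ge0 c z (fun=> ler01)).
rewrite /fubini_F => h.
have h2 : measurable_fun setT (fun x : R =>
  if x == 0 then besselK 0 0 else fine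
  (\int[mu]_t bessel_integrand c (cst 1%R) (x, t))).
  apply: measurable_fun_ifT => //; last exact: measurableT_comp.
  exact: measurable_fun_eqr.
apply: eq_measurable_fun h2 => x _; case: eqP => [->|/eqP x0];
  first by rewrite normr0 mulr0.
by rewrite bessel_integrand_section1//= mulr1.
Qed.

(** [K_0 (c |x|)] is a superposition over [t] of the functions
[e^(- c (cosh t) |x|)]; integrals against it reduce to exponential ones. *)
Lemma integral_besselK0_tonelli (c : R) (p : R -> R) : 0 < c ->
  measurable_fun setT p -> (forall x, 0 <= p x) ->
  (\int[mu]_x (besselK 0 (c * `|x|) * p x)%:E =
   \int[mu]_(t in `[0%R, +oo[) \int[mu]_x
     (expR (- (c * cosh t * `|x|)) * p x)%:E)%E.
Proof.
move=> c0 mp p0.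
have mm := measurable_bessel_integrand c mp.
transitivity (\int[mu]_x \int[mu]_t bessel_integrand c p (x, t))%E.
  have mD : measurable ([set: R] `\ (0 : R)) by exact: measurableD.
  rewrite -(@integral_setD1 R _ 0 setT)//; last first.
    apply: measurable_funTS; apply/measurable_EFinP;
      apply: measurable_funM => //.
    exact: measurable_besselK0.
  rewrite -[RHS](@integral_setD1 R _ 0 setT)//; last first.
    apply: measurable_funTS;
      apply: (measurable_fun_fubini_tonelli_F (m2 := mu) (bessel_integrand c p))
      => // z.
    exact: bessel_integrand_ge0.
  apply: eq_integral => x; rewrite inE/= => -[_ /eqP x0].
  by rewrite bessel_integrand_section1.
rewrite (fubini_tonelli (m1 := mu) (m2 := mu) (bessel_integrand c p))//;
  last by move=> z; exact: bessel_integrand_ge0.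
rewrite [RHS]integral_mkcond; apply: eq_integral => t _.
by rewrite bessel_integrand_section2 patchE.
Qed.

(** After the exchange of integrals, the substitution [v = c sinh t] underlies
the antiderivative: it is a sum of two arctangents of multiples of [sinh t]. *)
Lemma integral_besselK0_onePcos (c y th : R) : 0 < c ->
  (\int[mu]_x (besselK 0 (c * `|x|) * (1 + cos (y * x - th)))%:E =
   (pi / c + cos th * (pi / Num.sqrt (c ^+ 2 + y ^+ 2)))%:E)%E.
Proof.
move=> c0; have mc : measurable_fun setT (fun x : R => 1 + cos (y * x - th)).
  by apply: measurable_funD => //; exact: measurable_cos_affine.
have -> := integral_besselK0_tonelli c0 mc (fun x => onePcos_ge0 _).
have cc t : 0 < c * cosh t by rewrite mulr_gt0 ?cosh_gt0.
pose b := Num.sqrt (c ^+ 2 + y ^+ 2).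
have bb : b ^+ 2 = c ^+ 2 + y ^+ 2 by rewrite sqr_sqrtr// addr_ge0 ?sqr_ge0.
have b0 : 0 < b by rewrite sqrtr_gt0 ltr_pwDl ?sqr_ge0// exprn_gt0.
under eq_integral => t _ do rewrite integral_expabs_onePcos//.
pose sinh (t : R) := (expR t - expR (- t)) / 2.
have dsinh (t : R) : is_derive t (1 : R) sinh (cosh t).
  by apply: is_derive_eq; rewrite /GRing.scale/= /cosh; field.
have cs t : cosh t ^+ 2 = 1 + sinh t ^+ 2.
  rewrite /cosh /sinh expRN; field; by rewrite gt_eqF ?expR_gt0.
pose F (t : R) := 2 / c * atan (sinh t) +
  cos th * (2 / b * atan (c / b * sinh t)).
have dF (t : R) : is_derive t (1 : R) F
    (2 / (c * cosh t) + 2 * (c * cosh t) *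
      cos th / ((c * cosh t) ^+ 2 + y ^+ 2)).
  rewrite /F; apply: is_derive_eq; rewrite /GRing.scale/= -cs.
  have -> : (c * cosh t) ^+ 2 + y ^+ 2 = b ^+ 2 * (1 + (c / b * sinh t) ^+ 2).
    have -> : b ^+ 2 * (1 + (c / b * sinh t) ^+ 2) =
      b ^+ 2 + c ^+ 2 * sinh t ^+ 2.
      by field; rewrite gt_eqF.
    by rewrite bb exprMn cs; ring.
  have h0 : 1 + (c / b * sinh t) ^+ 2 != 0 by rewrite gt_eqF//
    ltr_pwDl ?sqr_ge0.
  move: h0; set D := 1 + _ => h0.
  by field; rewrite h0 !gt_eqF// cosh_gt0.
have sinhy : sinh t @[t --> +oo] --> +oo.
  have h : \forall t \near +oo, t / 2 <= sinh t.
    near=> t; have t0 : 0 <= t by near: t; exact: nbhs_pinfty_ge.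
    rewrite /sinh ler_pM2r// lerBrDr.
    apply: le_trans (expR_ge1Dx t); rewrite addrC lerD2r.
    by rewrite expR_le1 oppr_le0.
  apply: ger_cvgy h _.
  by apply: gt0_cvgMly => //; exact: cvg_id.
have FF : F t @[t --> +oo] --> (pi / c + cos th * (pi / b)).
  have -> : pi / c + cos th * (pi / b) =
    2 / c * (pi / 2) + cos th * (2 / b * (pi / 2)).
    by field; rewrite !gt_eqF.
  apply: cvgD.
    apply: cvgM; first exact: cvg_cst.
    exact: cvg_comp sinhy (@cvgy_atan R).
  apply: cvgM; first exact: cvg_cst.
  apply: cvgM; first exact: cvg_cst.
  apply: cvg_comp _ (@cvgy_atan R).
  by apply: gt0_cvgMry => //; rewrite divr_gt0.
rewrite (ge0_FTC2y_derive _ _ dF FF).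
- by rewrite /F /sinh oppr0 subrr mul0r mulr0 atan0 !mulr0 addr0 subr0.
- move=> t _.
  have h : 0 < (c * cosh t) ^+ 2 + y ^+ 2 by rewrite ltr_pwDl ?sqr_ge0//
    exprn_gt0.
  have -> : 2 / (c * cosh t) +
    2 * (c * cosh t) * cos th / ((c * cosh t) ^+ 2 + y ^+ 2) =
    2 / (c * cosh t) * ((c * cosh t) ^+ 2 * (1 + cos th) + y ^+ 2) /
      ((c * cosh t) ^+ 2 + y ^+ 2).
    by field; rewrite !gt_eqF// cosh_gt0.
  rewrite divr_ge0// ?(ltW h)// mulr_ge0 ?divr_ge0 ?(ltW (cc t))//.
  by rewrite addr_ge0 ?sqr_ge0// mulr_ge0 ?sqr_ge0// onePcos_ge0.
- have dG (t : R) : is_derive t (1 : R) (fun t => c * cosh t) (c * sinh t).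
    by rewrite /cosh; apply: is_derive_eq; rewrite /GRing.scale/= /sinh; field.
  have cG := continuous_derive dG.
  move=> t; apply: cvgD.
    apply: cvgM; first exact: cvg_cst.
    by apply: cvgV; [rewrite gt_eqF|exact: cG].
  apply: cvgM.
    by apply: cvgM; [apply: cvgM; [exact: cvg_cst|exact: cG]|exact: cvg_cst].
  apply: cvgV; first by rewrite gt_eqF// ltr_pwDl ?sqr_ge0// exprn_gt0.
  apply: cvgD; last exact: cvg_cst.
  by apply: cvgM; exact: cG.
Unshelve. all: by end_near. Qed.

Lemma integrable_besselK0 (c : R) : 0 < c ->
  mu.-integrable setT (EFin \o (fun x : R => besselK 0 (c * `|x|))).
Proof.
move=> c0; have mK := measurable_besselK0 c0; apply/integrableP; split.
  exact/measurable_EFinP.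
have := integral_besselK0_onePcos 0 0 c0; set r := (X in X%:E) => h.
apply: (@le_lt_trans _ _ r%:E); last exact: ltry.
rewrite -h; apply: ge0_le_integral => //.
- by apply/measurable_EFinP; exact: measurableT_comp.
- apply/measurable_EFinP; apply: measurable_funM => //.
  by under eq_fun do rewrite mul0r subr0 cos0; exact: measurable_cst.
- move=> x _; rewrite /= lee_fin ger0_norm ?besselK0_ge0//
    mul0r subr0 cos0 ler_peMr ?besselK0_ge0//.
  by rewrite lerDl.
Qed.

Lemma integral_besselK0 (c : R) : 0 < c ->
  \int[mu]_x besselK 0 (c * `|x|) = pi / c.
Proof.
move=> c0; have := integral_besselK0_onePcos 0 0 c0.
under eq_integral => x _ do rewrite mul0r subr0 cos0 EFinM muleC.
rewrite integralZl//; last exact: integrable_besselK0.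
rewrite expr0n addr0 cos0 sqrtr_sqr gtr0_norm// mul1r => /(congr1 (@fine R)).
rewrite fineM//; last by apply: integrable_fin_num => //;
  exact: integrable_besselK0.
rewrite /Rintegral /=; lra.
Qed.

Lemma integrable_besselK0_bounded (c K : R) (g : R -> R) : 0 < c ->
  measurable_fun setT g -> (forall x, `|g x| <= K) ->
  mu.-integrable setT (EFin \o (fun x : R => besselK 0 (c * `|x|) * g x)).
Proof.
move=> c0 mg gK.
have ig : mu.-integrable setT (fun x : R =>
  K%:E * (EFin \o (fun x : R => besselK 0 (c * `|x|))) x)%E.
  by apply: integrableZl => //; exact: integrable_besselK0.
apply: (le_integrable _ _ _ ig) => //.
  by apply/measurable_EFinP; apply: measurable_funM => //;
    exact: measurable_besselK0.
move=> x _; rewrite /= lee_fin !normrM mulrC ler_wpM2r//.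
by apply: le_trans (gK x) _; rewrite ler_norm.
Qed.

(** The Fourier transform of [K_0 (c |x|)] is the inverse multiquadric; the
phase [th] covers the sine transform, which vanishes, at the same time. *)
Lemma integral_besselK0_cos (c y th : R) : 0 < c ->
  \int[mu]_x (besselK 0 (c * `|x|) * cos (y * x - th)) =
   cos th * (pi / Num.sqrt (c ^+ 2 + y ^+ 2)).
Proof.
move=> c0; have := congr1 (@fine R) (integral_besselK0_onePcos y th c0).
have -> : fine (\int[mu]_x (besselK 0 (c * `|x|) * (1 + cos (y * x - th)))%:E) =
  \int[mu]_x (besselK 0 (c * `|x|) + besselK 0 (c * `|x|) * cos (y * x - th)).
  by apply: eq_Rintegral => x _; rewrite mulrDr mulr1.
rewrite RintegralD//; first last.
- apply: (@integrable_besselK0_bounded _ 1) => //;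
    first exact: measurable_cos_affine.
  by move=> x; exact: cos_max.
- exact: integrable_besselK0.
rewrite integral_besselK0//= => h; apply: (addrI (pi / c)); exact: h.
Qed.

(** The exact moment is a constant times the integral of [1 / (cosh t)^(2n+1)];
the crude bound [cosh t >= e^t / 2] is enough here. *)
Lemma integral_besselK0_pow (c : R) n : 0 < c ->
  (\int[mu]_x (besselK 0 (c * `|x|) * x ^+ n.*2)%:E <=
    (4 * n.*2`!%:R / c ^+ n.*2.+1)%:E)%E.
Proof.
move=> c0.
have xn (x : R) : 0 <= x ^+ n.*2 by rewrite -mul2n exprM exprn_ge0 ?sqr_ge0.
rewrite integral_besselK0_tonelli//.
have cc t : 0 < c * cosh t by rewrite mulr_gt0 ?cosh_gt0.
under eq_integral => t _ do rewrite integral_expR_even_pow//.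
pose K := 4 * n.*2`!%:R / c ^+ n.*2.+1.
have K0 : 0 <= K by rewrite divr_ge0 ?mulr_ge0 ?exprn_ge0// ltW.
have -> : K%:E = (\int[mu]_(t in `[0%R, +oo[) (K%:E * (expR (- t))%:E))%E.
  rewrite ge0_integralZl//; last first.
    by apply/measurable_EFinP; apply: measurable_funTS; apply: measurableT_comp.
  have -> : (\int[mu]_(t in `[0%R, +oo[) (expR (- t))%:E =
    \int[mu]_(t in `[0%R, +oo[) (expR (- (1 * t)) * t ^+ 0)%:E)%E.
    by apply: eq_integral => t _; rewrite mul1r expr0 mulr1.
  by rewrite integral_expR_pow// expr1n fact0 divr1 mule1.
apply: ge0_le_integral => //.
- by move=> t _; rewrite lee_fin divr_ge0 ?mulr_ge0 ?exprn_ge0// ltW.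
- apply/measurable_EFinP; apply: measurable_funTS;
    apply: continuous_measurable_fun => t.
  apply: cvgM; first exact: cvg_cst.
  apply: cvgV; first by rewrite expf_neq0// gt_eqF.
  apply: (@continuous_comp _ _ _ (fun t => c * cosh t) (fun x => x ^+ _));
    last exact: exprn_continuous.
  by apply: cvgM; [exact: cvg_cst|exact: continuous_cosh].
- apply/measurable_EFinP; apply: measurable_funTS; apply: measurable_funM => //.
  exact: measurableT_comp.
- move=> t _; rewrite -EFinM lee_fin /K exprMn expRN.
  have h : expR t / 2 <= cosh t ^+ n.*2.+1.
    by apply: le_trans (cosh_ge_expR t) _;
      rewrite exprS ler_peMr ?exprn_ege1 ?cosh_ge1// ltW// cosh_gt0.
  have -> : 4 * n.*2`!%:R / c ^+ n.*2.+1 / expR t =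
    2 * n.*2`!%:R / (c ^+ n.*2.+1 * (expR t / 2)).
    by field; rewrite !gt_eqF ?expR_gt0 ?exprn_gt0.
  rewrite ler_wpM2l ?mulr_ge0//.
  have ct := exprn_gt0 n.*2.+1 (cosh_gt0 t).
  have ec : 0 < c ^+ n.*2.+1 by rewrite exprn_gt0.
  have et : 0 < expR t / 2 by rewrite divr_gt0 ?expR_gt0.
  by rewrite lef_pV2 ?posrE ?(mulr_gt0 ec)// ler_pM2l.
Qed.

End bessel.

(** * Interpolation of a trigonometric function at the nodes *)

Section interp.
Variable R : realType.

(** A class of functions closed under differentiation and containing both the
function to interpolate and the interpolation polynomial. *)
Definition wave (a b w : R) (p : {poly R}) (y : R) : R :=
  a * cos (w * y) + b * sin (w * y) + p.[y].

Lemma is_derive_wave a b w p (y : R) :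
  is_derive y (1 : R) (wave a b w p) (wave (b * w) (- (a * w)) w p^`() y).
Proof.
by rewrite /wave; apply: is_derive_eq; rewrite /GRing.scale/=; ring.
Qed.

Lemma continuous_wave a b w p : continuous (wave a b w p).
Proof.
move=> y; apply: differentiable_continuous; apply/derivable1_diffP.
by have [] := is_derive_wave a b w p y.
Qed.

(** Rolle's theorem between consecutive zeros.  The new zeros lie beyond [x],
which is what keeps the list sorted in the induction. *)
Lemma wave_zeros_derive a b w p x s : path <%R x s ->
  wave a b w p x = 0 -> (forall y, y \in s -> wave a b w p y = 0) ->
  exists s', [/\ size s' = size s, path <%R x s' &
    forall y, y \in s' -> wave (b * w) (- (a * w)) w p^`() y = 0].
Proof.
elim: s x => [|y s IH] x /=; first by move=> _ _ _; exists [::].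
move=> /andP[xy ys] x0 s0.
have y0 : wave a b w p y = 0 by apply: s0; rewrite mem_head.
have [|s' [ss' ys' s'0]] := IH y ys y0.
  by move=> z zs; apply: s0; rewrite inE zs orbT.
have [|||z xzy dz] := @Rolle R (wave a b w p) x y xy.
- by move=> z _; have [] := is_derive_wave a b w p z.
- by apply: continuous_subspaceT; exact: continuous_wave.
- by rewrite x0 y0.
move: xzy; rewrite in_itv/= => /andP[xz zy].
exists (z :: s'); split => /=; first by rewrite ss'.
  rewrite xz /=; apply: path_le ys' => //; exact: lt_trans.
move=> t; rewrite inE => /predU1P[->|]; last exact: s'0.
have [_ <-] := is_derive_wave a b w p z.
by have [_ ->] := dz.
Qed.

(** Each differentiation multiplies the amplitude [sqrt (a^2 + b^2)] by [|w|].
*)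
Lemma wave_zeros_deriven k a b w p x s : size s = k -> path <%R x s ->
  wave a b w p x = 0 -> (forall y, y \in s -> wave a b w p y = 0) ->
  exists z a' b', a' ^+ 2 + b' ^+ 2 = (a ^+ 2 + b ^+ 2) * (w ^+ k) ^+ 2 /\
    wave a' b' w p^`(k) z = 0.
Proof.
elim: k a b p x s => [|k IH] a b p x s.
  by move=> _ _ x0 _; exists x, a, b; rewrite expr0 expr1n mulr1.
move=> sk xs x0 s0.
have [[|x' s'] [ss' xs' s'0]] := wave_zeros_derive xs x0 s0.
  by move: ss'; rewrite sk.
have [||||z [a' [b' [ab z0]]]] := IH (b * w) (- (a * w)) p^`() x' s'.
- by move: ss'; rewrite sk => -[].
- by move: xs' => /= /andP[].
- by apply: s'0; rewrite mem_head.
- by move=> y ys; apply: s'0; rewrite inE ys orbT.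
exists z, a', b'; split; first by rewrite ab [w ^+ k.+1]exprS; ring.
by rewrite derivSn.
Qed.

Lemma derivn_lead (p : {poly R}) k : (size p <= k.+1)%N ->
  p^`(k) = (k`!%:R * p`_k)%:P.
Proof.
move=> sp; apply/polyP => i; rewrite coef_derivn coefC.
case: i => [|i] /=; first by rewrite addn0 ffactnn mulr_natl.
by rewrite nth_default ?mul0rn// (leq_trans sp)// addnS ltnS leq_addr.
Qed.

Variables (xs : nat -> R) (n : nat).
Hypotheses (n0 : (0 < n)%N) (xs_inj : injective xs).

Definition lagrange_weight (x : R) (j : 'I_n) : R :=
  (tnth (lagrange n xs) j : {poly R}).[x].

(** The Lagrange remainder.  The multiple of the node polynomial that makes the
error vanish at [x] as well produces one more zero, hence a zero of the [n]-th
derivative, in which the interpolation polynomial no longer occurs. *)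
Lemma lagrange_wave_error (a b w x : R) (g : R -> R) :
  (forall y, g y = a * cos (w * y) + b * sin (w * y)) ->
  n`!%:R ^+ 2 * (g x - \sum_(j < n) lagrange_weight x j * g (xs j)) ^+ 2 <=
  (a ^+ 2 + b ^+ 2) * (w ^+ n) ^+ 2 * (\prod_(j < n) (x - xs j)) ^+ 2.
Proof.
move=> gE.
have rhs0 : 0 <= (a ^+ 2 + b ^+ 2) * (w ^+ n) ^+ 2 *
  (\prod_(j < n) (x - xs j)) ^+ 2.
  by apply: mulr_ge0; rewrite ?sqr_ge0//; apply: mulr_ge0;
    rewrite ?sqr_ge0// addr_ge0 ?sqr_ge0.
have [/existsP[j /eqP xj]|xN] := boolP [exists j : 'I_n, x == xs j].
  rewrite (_ : _ - _ = 0) ?expr0n ?mulr0//.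
  rewrite (bigD1 j)//= big1; last first.
    by move=> i ij; rewrite /lagrange_weight xj lagrange_sample//
      (negbTE ij) mul0r.
  by rewrite /lagrange_weight xj lagrange_sample// eqxx mul1r addr0 subrr.
pose L : {poly R} :=
  \sum_(j < n) g (xs j) *: (tnth (lagrange n xs) j : {poly R}).
have LE y : L.[y] = \sum_(j < n) lagrange_weight y j * g (xs j).
  by rewrite /L horner_sum; apply: eq_bigr => j _; rewrite hornerZ mulrC.
have Lnode (j : 'I_n) : L.[xs j] = g (xs j).
  rewrite LE (bigD1 j)//= big1; last first.
    by move=> i ij; rewrite /lagrange_weight lagrange_sample//
      (negbTE ij) mul0r.
  by rewrite /lagrange_weight lagrange_sample// eqxx mul1r addr0.
have sL : (size L <= n)%N.
  rewrite /L; apply: leq_trans (size_sum _ _ _) _; apply/bigmax_leqP => j _.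
  by apply: leq_trans (size_scale_leq _ _) _; rewrite size_lagrange_.
pose om : {poly R} := \prod_(j < n) ('X - (xs j)%:P).
have omE y : om.[y] = \prod_(j < n) (y - xs j).
  by rewrite /om horner_prod; apply: eq_bigr => j _; rewrite hornerXsubC.
have som : size om =
  n.+1 by rewrite /om size_prod_XsubC /index_enum -enumT size_enum_ord.
have omn : om`_n = 1.
  have /monicP := monic_prod_XsubC (index_enum 'I_n) predT (fun j => xs j).
  by rewrite /lead_coef -/om som.
have omx : om.[x] != 0.
  rewrite omE; apply/prodf_neq0 => j _; rewrite subr_eq0.
  by move: xN; rewrite negb_exists => /forallP.
rewrite -LE -omE.
(* [K] is chosen so that [x] becomes a zero of the remainder *)
pose K := (g x - L.[x]) / om.[x].
pose p := - L - K *: om.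
have wE y : wave a b w p y = g y - L.[y] - K * om.[y].
  by rewrite /wave /p hornerD !hornerN hornerZ addrA gE.
pose t := sort <=%R (x :: [seq xs j | j <- iota 0 n]).
have tu : sorted <%R t.
  rewrite sort_lt_sorted /= map_inj_uniq// iota_uniq andbT.
  apply/mapP => -[j]; rewrite mem_iota add0n => /andP[_ jn] xj.
  by move: xN; rewrite negb_exists => /forallP/(_ (Ordinal jn)) /=;
    rewrite xj eqxx.
have t0 y : y \in t -> wave a b w p y = 0.
  rewrite mem_sort inE wE => /predU1P[->|/mapP[j]].
    by rewrite /K divfK// subrr.
  rewrite mem_iota add0n => /andP[_ jn] ->.
  rewrite (Lnode (Ordinal jn)) subrr sub0r omE (bigD1 (Ordinal jn))//= subrr
    mul0r mulr0.
  by rewrite oppr0.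
have st : size t = n.+1 by rewrite size_sort /= size_map size_iota.
clearbody t; case: t tu t0 st => [//|x0 s] /= tu t0 [sn].
have [|z [a' [b' [ab]]]] := wave_zeros_deriven sn tu (t0 x0 (mem_head _ _)).
- by move=> y ys; apply: t0; rewrite inE ys orbT.
rewrite derivn_lead; last first.
  rewrite /p (leq_trans (size_polyD _ _))//
    !size_polyN geq_max (leq_trans sL)//=.
  by rewrite (leq_trans (size_scale_leq _ _))// som.
have -> : p`_n = - K.
  by rewrite /p coefD !coefN coefZ omn mulr1 nth_default// oppr0 add0r.
rewrite /wave hornerC => h.
have hK : n`!%:R * K = a' * cos (w * z) + b' * sin (w * z) by lra.
have -> : g x - L.[x] = K * om.[x] by rewrite /K divfK.
rewrite exprMn mulrA -exprMn hK ler_wpM2r ?sqr_ge0//.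
rewrite -ab -[leRHS]mulr1 -(cos2Dsin2 (w * z)) -subr_ge0.
rewrite (_ : _ - _ = (a' * sin (w * z) - b' * cos (w * z)) ^+ 2); last by ring.
exact: sqr_ge0.
Qed.

(** The error of a complex exponential at [x] is the vector [(e1, e2)] of the
errors of its real and imaginary parts; the remainder formula is applied to the
combination of cosine and sine with coefficients [e1] and [e2], whose error is
[e1^2 + e2^2]. *)
Lemma lagrange_exp_error (w x r : R) : (forall j : 'I_n, `|x - xs j| <= r) ->
  (cos (w * x) - \sum_(j < n) lagrange_weight x j * cos (w * xs j)) ^+ 2 +
  (sin (w * x) - \sum_(j < n) lagrange_weight x j * sin (w * xs j)) ^+ 2 <=
  (r ^+ n / n`!%:R) ^+ 2 * w ^+ n.*2.
Proof.
move=> hr; set e1 := cos _ - _; set e2 := sin _ - _.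
have r0 : 0 <= r by apply: le_trans (hr (Ordinal n0)).
have := @lagrange_wave_error e1 e2 w x _ (fun=> erefl) => /=.
rewrite (_ : _ - _ = e1 ^+ 2 + e2 ^+ 2); last first.
  under eq_bigr do rewrite mulrDr mulrCA [X in _ + X]mulrCA.
  by rewrite big_split/= -!mulr_sumr /e1 /e2; ring.
set S := e1 ^+ 2 + e2 ^+ 2 => h.
have S0 : 0 <= S by rewrite addr_ge0 ?sqr_ge0.
have f0 : 0 < (n`!%:R : R) by rewrite ltr0n fact_gt0.
have hp : (\prod_(j < n) (x - xs j)) ^+ 2 <= (r ^+ n) ^+ 2.
  rewrite -[leLHS]real_normK ?num_real// ler_pXn2r ?nnegrE ?exprn_ge0//
    normr_prod.
  rewrite -[n in leRHS]card_ord -prodr_const.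
  by apply: ler_prod => j _; rewrite normr_ge0 hr.
have [->|SN0] := eqVneq S 0.
  by rewrite mulr_ge0 ?sqr_ge0// -mul2n exprM exprn_ge0 ?sqr_ge0.
have {}SN0 : 0 < S by rewrite lt_neqAle eq_sym SN0.
have -> : (r ^+ n / n`!%:R) ^+ 2 * w ^+ n.*2 =
  (w ^+ n) ^+ 2 * (r ^+ n) ^+ 2 / n`!%:R ^+ 2.
  by rewrite -exprM muln2; field; rewrite gt_eqF.
rewrite ler_pdivlMr ?exprn_gt0// -(ler_pM2l SN0) mulrA -expr2 mulrC.
apply: le_trans h _; rewrite -mulrA; apply: ler_wpM2l => //.
by apply: ler_wpM2l hp; exact: sqr_ge0.
Qed.

End interp.

(** * Interpolation by a positive semidefinite kernel *)

Section native.
Variable R : realType.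

(** The squared norm of [\sum_i p_i k (. - y_i)] in the native space of [k]. *)
Definition kernel_form (k : R -> R) m (p y : 'I_m -> R) : R :=
  \sum_(i < m) \sum_(j < m) p i * p j * k (y i - y j).

(** The Cauchy-Schwarz argument, stated for the quadratic it uses. *)
Lemma sqr_le_of_quadratic (E N P : R) : 0 <= P ->
  (forall t, 2 * t * E <= N + t ^+ 2 * P) -> E ^+ 2 <= N * P.
Proof.
move=> P0 h; have [P00|PN0] := eqVneq P 0.
  have [->|E0] := eqVneq E 0; first by rewrite expr0n P00 mulr0.
  have := h ((N + 1) / E / 2); rewrite P00 mulr0 addr0.
  rewrite (_ : 2 * _ * E = N + 1); last by field.
  lra.
have PP : 0 < P by rewrite lt_neqAle eq_sym PN0.
have := h (E / P).
rewrite (_ : 2 * _ * E = 2 * (E ^+ 2 / P)); last by field.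
rewrite (_ : _ ^+ 2 * P = E ^+ 2 / P); last by field.
move=> hh; rewrite -ler_pdivrMr//; lra.
Qed.

Variables (k u s : R -> R) (N : R).
Hypothesis ksym : forall y, k (- y) = k y.
Hypothesis psd : forall m (p y : 'I_m -> R), 0 <= kernel_form k p y.
Hypothesis dual : forall m (p y : 'I_m -> R),
  2 * (\sum_(i < m) p i * u (y i)) <= N + kernel_form k p y.

(** Adjoining the evaluation point to the nodes, as index [0]. *)
Definition cons_ord m (p0 : R) (p : 'I_m -> R) (i : 'I_m.+1) : R :=
  if unlift ord0 i is Some j then p j else p0.

Lemma cons_ord0 m p0 (p : 'I_m -> R) : cons_ord p0 p ord0 = p0.
Proof. by rewrite /cons_ord unlift_none. Qed.

Lemma cons_ord_lift m p0 (p : 'I_m -> R) j : cons_ord p0 p (lift ord0 j) = p j.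
Proof. by rewrite /cons_ord liftK. Qed.

Lemma kernel_form_cons m p0 x (p y : 'I_m -> R) :
  kernel_form k (cons_ord p0 p) (cons_ord x y) =
  p0 ^+ 2 * k 0 + 2 * p0 * (\sum_(j < m) p j * k (x - y j)) + kernel_form k p y.
Proof.
rewrite /kernel_form big_ord_recl big_ord_recl !cons_ord0 subrr.
under eq_bigr do rewrite !cons_ord_lift.
under [X in _ + X]eq_bigr => i _.
  rewrite big_ord_recl !cons_ord_lift !cons_ord0.
  under eq_bigr do rewrite !cons_ord_lift.
  over.
rewrite big_split /= -expr2 !addrA; congr (_ + _); rewrite -addrA;
  congr (_ + _).
rewrite -[2 * p0 * _]mulrA mulr_natl mulr2n; congr (_ + _); rewrite ?mulr_sumr;
  apply: eq_bigr => i _; first by rewrite mulrA.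
by rewrite -ksym opprB; ring.
Qed.

(** Duality is applied to the coefficients [a] of the interpolant plus [t] times
the functional [delta - \sum_j g_j delta_(x_j)].  The interpolation conditions
turn both [\sum_i a_i u (x_i)] and the form of [a] into the same nonnegative
number, which can be dropped. *)
Lemma native_interpolation_error m (a x : 'I_m -> R) (g : 'I_m -> R) (t : R) :
  (forall z, s z = \sum_(j < m) a j * k (z - x j)) ->
  (forall i, s (x i) = u (x i)) ->
  (u t - s t) ^+ 2 <= N *
    kernel_form k (cons_ord 1 (fun j => - g j)) (cons_ord t x).
Proof.
move=> sE su; apply: sqr_le_of_quadratic => // la.
have := dual (cons_ord la (fun j => a j - la * g j)) (cons_ord t x).
rewrite !kernel_form_cons big_ord_recl !cons_ord0.
under eq_bigr do rewrite !cons_ord_lift.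
have -> : \sum_(j < m) (a j - la * g j) * k (t - x j) =
  s t + la * (\sum_(j < m) - g j * k (t - x j)).
  rewrite sE mulr_sumr -big_split/=; apply: eq_bigr => j _; ring.
have -> : \sum_(i < m) (a i - la * g i) * u (x i) =
  \sum_(i < m) a i * u (x i) - la * (\sum_(i < m) g i * u (x i)).
  rewrite mulr_sumr -sumrB/=; apply: eq_bigr => j _; ring.
have -> : kernel_form k (fun j => a j - la * g j) x =
  \sum_(i < m) a i * u (x i) - 2 * la * (\sum_(i < m) g i * u (x i)) +
  la ^+ 2 * kernel_form k (fun j => - g j) x.
  rewrite /kernel_form.
  have e1 : \sum_(i < m) a i * u (x i) =
    \sum_(i < m) \sum_(j < m) a i * a j * k (x i - x j).
    apply: eq_bigr => i _; rewrite -su sE mulr_sumr; apply: eq_bigr => j _;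
      ring.
  have e2 : \sum_(i < m) g i * u (x i) =
    \sum_(i < m) \sum_(j < m) g i * a j * k (x i - x j).
    apply: eq_bigr => i _; rewrite -su sE mulr_sumr; apply: eq_bigr => j _;
      ring.
  have e3 : \sum_(i < m) g i * u (x i) =
    \sum_(i < m) \sum_(j < m) a i * g j * k (x i - x j).
    rewrite e2 exchange_big/=; apply: eq_bigr => i _; apply: eq_bigr => j _.
    by rewrite -ksym opprB; ring.
  have -> : 2 * la * (\sum_(i < m) g i * u (x i)) =
    la * (\sum_(i < m) \sum_(j < m) g i * a j * k (x i - x j)) +
    la * (\sum_(i < m) \sum_(j < m) a i * g j * k (x i - x j)).
    by rewrite -e2 -e3; ring.
  rewrite e1 !mulr_sumr opprD addrA -!sumrB -big_split/=; apply: eq_bigr => i _.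
  rewrite !mulr_sumr -!sumrB -big_split/=; apply: eq_bigr => j _; ring.
have : 0 <= \sum_(i < m) a i * u (x i).
  have := psd a x; rewrite /kernel_form; congr (_ <= _).
  apply: eq_bigr => i _; rewrite -su sE mulr_sumr; apply: eq_bigr => j _; ring.
rewrite expr1n mul1r mulr1; nra.
Qed.

End native.

(** * Pointwise Fourier inversion for band-limited functions *)

Section Rint.
Variable R : realType.
Notation mu := (@lebesgue_measure R).

Lemma integrable_dominated (D : set R) (a b : R -> R) : measurable D ->
  measurable_fun D a -> mu.-integrable D (EFin \o b) ->
  (forall x, D x -> `|a x| <= b x) -> mu.-integrable D (EFin \o a).
Proof.
move=> mD ma ib ab; apply: (le_integrable _ _ _ ib) => //;
  first exact/measurable_EFinP.
by move=> x Dx /=; rewrite lee_fin (le_trans (ab x Dx))// ler_norm.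
Qed.

Lemma normr_Rintegral_le (D : set R) (a b : R -> R) : measurable D ->
  mu.-integrable D (EFin \o a) -> mu.-integrable D (EFin \o b) ->
  (forall x, D x -> `|a x| <= b x) ->
  `|\int[mu]_(x in D) a x| <= \int[mu]_(x in D) b x.
Proof.
move=> mD ia ib ab; apply: le_trans (le_normr_Rintegral _ _) _ => //.
apply: le_Rintegral => //; exact: integrable_norm.
Qed.

Lemma ge0_integrable (D : set R) (a : R -> R) : measurable_fun D a ->
  (forall x, 0 <= a x) -> (\int[mu]_(x in D) (a x)%:E < +oo)%E ->
  mu.-integrable D (EFin \o a).
Proof.
move=> ma a0 ai; apply/integrableP; split; first exact/measurable_EFinP.
by under eq_integral do rewrite /= ger0_norm//.
Qed.

Lemma integrableDR (D : set R) (a b : R -> R) : measurable D ->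
  mu.-integrable D (EFin \o a) -> mu.-integrable D (EFin \o b) ->
  mu.-integrable D (EFin \o (fun x => a x + b x)).
Proof. by move=> mD ia ib; exact: (@integrableD _ _ _ mu D mD _ _ ia ib). Qed.

Lemma integrableBR (D : set R) (a b : R -> R) : measurable D ->
  mu.-integrable D (EFin \o a) -> mu.-integrable D (EFin \o b) ->
  mu.-integrable D (EFin \o (fun x => a x - b x)).
Proof. by move=> mD ia ib; exact: (@integrableB _ _ _ mu D mD _ _ ia ib). Qed.

Lemma integrableZR (D : set R) k (a : R -> R) : measurable D ->
  mu.-integrable D (EFin \o a) -> mu.-integrable D (EFin \o (fun x => k * a x)).
Proof. by move=> mD ia; exact: (@integrableZl _ _ _ mu D mD k _ ia). Qed.

(** In the applications the bounded factor is a cosine, a sine or a damping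
exponential. *)
Lemma integrable_boundedM (D : set R) (a b : R -> R) : measurable D ->
  mu.-integrable D (EFin \o a) -> measurable_fun D b ->
    (forall x, `|b x| <= 1) ->
  mu.-integrable D (EFin \o (fun x => a x * b x)).
Proof.
move=> mD ia mb b1; apply: integrable_dominated (integrable_norm ia) _ => //.
  apply: measurable_funM => //; by apply/measurable_EFinP;
    exact: measurable_int ia.
by move=> x _ /=; rewrite normrM ler_piMr.
Qed.

Lemma expabs_le1 (e x : R) : 0 < e -> expR (- (e * `|x|)) <= 1.
Proof. by move=> e0; rewrite expR_le1 oppr_le0 mulr_ge0// ltW. Qed.

Lemma integrable_expabs (e : R) : 0 < e ->
  mu.-integrable setT (EFin \o (fun x : R => expR (- (e * `|x|)))).
Proof.
move=> e0; apply: ge0_integrable; first exact: measurable_expabs.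
  by move=> x; exact: expR_ge0.
have := integral_expR_even_pow 0 e0.
under eq_integral do rewrite expr0 mulr1.
by move=> ->; exact: ltry.
Qed.

Lemma Rintegral_expabs (e : R) : 0 < e ->
  \int[mu]_x expR (- (e * `|x|)) = 2 / e.
Proof.
move=> e0; have := integral_expR_even_pow 0 e0.
under eq_integral do rewrite expr0 mulr1.
by move=> /(congr1 (@fine R)) => h; rewrite /Rintegral h/= fact0 mulr1 expr1.
Qed.

Lemma Rintegral_expcos (e a th : R) : 0 < e ->
  \int[mu]_x (expR (- (e * `|x|)) * cos (a * x - th)) =
    2 * e * cos th / (e ^+ 2 + a ^+ 2).
Proof.
move=> e0; have := congr1 (@fine R) (integral_expabs_onePcos a th e0).
have -> : fine (\int[mu]_x (expR (- (e * `|x|)) * (1 + cos (a * x - th)))%:E) =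
   \int[mu]_x (expR (- (e * `|x|)) + expR (- (e * `|x|)) * cos (a * x - th)).
  by apply: eq_Rintegral => x _; rewrite mulrDr mulr1.
rewrite RintegralD//; first last.
- apply: integrable_boundedM => //; first exact: integrable_expabs.
    exact: measurable_cos_affine.
  by move=> x; exact: cos_max.
- exact: integrable_expabs.
by rewrite Rintegral_expabs//= => /addrI.
Qed.

Section fubini.
Variables (v : R -> R) (e y th : R).
Hypotheses (iv : mu.-integrable setT (EFin \o v)) (e0 : 0 < e).

Let mv : measurable_fun setT v.
Proof. by apply/measurable_EFinP; exact: measurable_int iv. Qed.

Let h (z : R * R) :=
  (expR (- (e * `|z.1|)) * (v z.2 * cos ((y - z.2) * z.1 - th)))%:E.

Let mh : measurable_fun setT h.
Proof.
apply/measurable_EFinP; apply: measurable_funM.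
  apply: (@measurableT_comp _ _ _ _ _ _ (fun x : R => expR (- (e * `|x|)))).
    exact: measurable_expabs.
  exact: measurable_fst.
apply: measurable_funM; first by apply: measurableT_comp => //;
  exact: measurable_snd.
apply: measurableT_comp.
  by apply: continuous_measurable_fun; exact: continuous_cos.
apply: measurable_funB => //; apply: measurable_funM;
  last exact: measurable_fst.
by apply: measurable_funB => //; exact: measurable_snd.
Qed.

Let ivc w : mu.-integrable setT
  (EFin \o (fun x => v x * cos ((y - x) * w - th))).
Proof.
apply: integrable_boundedM => //; last by move=> x; exact: cos_max.
under eq_fun => x do rewrite mulrC mulrBr -addrA [- (w * x) + _]addrC addrA
  -mulNr addrC.
by under eq_fun => x do rewrite -[_ - _]opprK opprB;
  exact: measurable_cos_affine.
Qed.

Let ih : (mu \x mu)%E.-integrable setT h.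
Proof.
apply/integrable12ltyP => //.
apply: (@le_lt_trans _ _
  (\int[mu]_x ((expR (- (e * `|x|)))%:E * (\int[mu]_t `|v t|)%:E))%E).
  apply: ge0_le_integral => //.
  - by move=> x _; exact: integral_ge0.
  - apply: (measurable_fun_fubini_tonelli_F (m2 := mu) (fun z => `|h z|%E)) =>
      //.
    exact: measurableT_comp.
  - by apply: emeasurable_funM => //; apply/measurable_EFinP;
      exact: measurable_expabs.
  - move=> x _; rewrite -EFinM mulrC EFinM.
    have -> : (\int[mu]_t `|v t|)%:E = (\int[mu]_t `|v t|%:E)%E.
      by rewrite /Rintegral fineK//; apply: integrable_fin_num => //;
        exact: integrable_norm.
    rewrite -ge0_integralZr//; last first.
      by apply/measurable_EFinP; exact: measurableT_comp.
    apply: ge0_le_integral => //.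
    + by apply: measurableT_comp => //; exact: measurable_fun_pair2.
    + by apply: emeasurable_funM => //; apply/measurable_EFinP;
        exact: measurableT_comp.
    + move=> t _; rewrite /h/= -EFinM lee_fin normrM (ger0_norm (expR_ge0 _))
        mulrC.
      by rewrite ler_wpM2r ?expR_ge0// normrM ler_piMr// cos_max.
rewrite ge0_integralZr//; last 2 first.
- by apply/measurable_EFinP; exact: measurable_expabs.
- by rewrite lee_fin; apply: Rintegral_ge0 => t _.
have -> : (\int[mu]_x (expR (- (e * `|x|)))%:E)%E = (2 / e)%:E.
  rewrite -Rintegral_expabs// /Rintegral fineK//.
  by apply: integrable_fin_num => //; exact: integrable_expabs.
by rewrite -EFinM ltry.
Qed.

Let FE w : (\int[mu]_x h (w, x) =
  (expR (- (e * `|w|)) * \int[mu]_x (v x * cos ((y - x) * w - th)))%:E)%E.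
Proof.
rewrite EFinM /Rintegral fineK; last by apply: integrable_fin_num => //;
  exact: ivc.
by rewrite -integralZl//; exact: ivc.
Qed.

Let GE x : (\int[mu]_w h (w, x) =
  (v x * (2 * e * cos th / (e ^+ 2 + (y - x) ^+ 2)))%:E)%E.
Proof.
rewrite -Rintegral_expcos// EFinM.
have ie : mu.-integrable setT
  (EFin \o (fun w => expR (- (e * `|w|)) * cos ((y - x) * w - th))).
  apply: integrable_boundedM => //; first exact: integrable_expabs.
    exact: measurable_cos_affine.
  by move=> w; exact: cos_max.
rewrite /Rintegral fineK; last exact: integrable_fin_num.
rewrite -integralZl//; apply: eq_integral => w _.
by rewrite /h/= -EFinM; congr EFin; ring.
Qed.

Lemma integrable_expabs_transform :
  mu.-integrable setT (EFin \o (fun w =>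
    expR (- (e * `|w|)) * \int[mu]_x (v x * cos ((y - x) * w - th)))).
Proof.
have := integrable_fubini_F ih; apply: eq_integrable => // w _.
by rewrite /fubini_F FE.
Qed.

(** Integrating a Fourier transform against [e^(- e |w|)] amounts to integrating
the function itself against a multiple of the Poisson kernel. *)
Lemma Rintegral_expabs_transform :
  \int[mu]_w (expR (- (e * `|w|)) * \int[mu]_x (v x * cos ((y - x) * w - th))) =
  \int[mu]_x (v x * (2 * e * cos th / (e ^+ 2 + (y - x) ^+ 2))).
Proof.
rewrite /Rintegral; congr fine.
under eq_integral => w _ do rewrite -FE.
under [RHS]eq_integral => x _ do rewrite -GE.
exact: (Fubini ih).
Qed.

(** The damped transform is measurable by Fubini's theorem, and the damping can
be undone. *)
Lemma measurable_transform :
  measurable_fun setT (fun w => \int[mu]_x (v x * cos ((y - x) * w - th))).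
Proof.
have h1 : measurable_fun setT (fun w : R =>
  expR (- (e * `|w|)) * \int[mu]_x (v x * cos ((y - x) * w - th))).
  by apply/measurable_EFinP; exact: measurable_int integrable_expabs_transform.
have h2 : measurable_fun setT (fun w : R => expR (e * `|w|)).
  by apply: measurableT_comp => //; apply: measurable_funM.
have := measurable_funM h2 h1; apply: eq_measurable_fun => w _ /=.
by rewrite mulrA -expRD subrr expR0 mul1r.
Qed.

End fubini.

Lemma poisson_half (e y : R) : 0 < e ->
  (\int[mu]_(x in `[0%R, +oo[) (e / (e ^+ 2 + (x - y) ^+ 2))%:E =
    (pi / 2 - atan (- y / e))%:E)%E.
Proof.
move=> e0.
have p0 (x : R) : 0 < e ^+ 2 + (x - y) ^+ 2 by rewrite ltr_pwDl ?sqr_ge0//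
  exprn_gt0.
pose F (x : R) := atan (e^-1 * (x - y)).
have dF (x : R) : is_derive x (1 : R) F (e / (e ^+ 2 + (x - y) ^+ 2)).
  rewrite /F; apply: is_derive_eq; rewrite /GRing.scale/=.
  have h0 : e ^+ 2 + (x - y) ^+ 2 =
    e ^+ 2 * (1 + (e^-1 * (x - y)) ^+ 2) by field; rewrite gt_eqF.
  have := p0 x; rewrite h0 pmulr_rgt0 ?exprn_gt0//; set D := 1 + _ => D0.
  by field; rewrite !gt_eqF.
have FF : F x @[x --> +oo] --> pi / 2.
  apply: cvg_comp _ (@cvgy_atan R).
  by apply: gt0_cvgMry; [rewrite invr_gt0|exact: cvg_addrr].
rewrite (ge0_FTC2y_derive _ _ dF FF).
- by rewrite /F sub0r [e^-1 * _]mulrC.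
- by move=> x _; rewrite divr_ge0 // ltW.
- move=> x; apply: cvgM; first exact: cvg_cst.
  apply: cvgV; first by rewrite gt_eqF.
  apply: cvgD; first exact: cvg_cst.
  apply: (@continuous_comp _ _ _ (fun x => x - y) (fun x => x ^+ 2));
    last exact: exprn_continuous.
  by apply: cvgB; [exact: cvg_id|exact: cvg_cst].
Qed.

(** Normalised to have integral [1]. *)
Definition poisson (e y x : R) := pi^-1 * (e / (e ^+ 2 + (x - y) ^+ 2)).

Lemma measurable_poisson (e y : R) : 0 < e -> measurable_fun setT (poisson e y).
Proof.
move=> e0; apply: continuous_measurable_fun => x.
apply: cvgM; first exact: cvg_cst.
apply: cvgM; first exact: cvg_cst.
apply: cvgV; first by rewrite gt_eqF// ltr_pwDl ?sqr_ge0// exprn_gt0.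
apply: cvgD; first exact: cvg_cst.
apply: (@continuous_comp _ _ _ (fun x => x - y) (fun x => x ^+ 2));
  last exact: exprn_continuous.
by apply: cvgB; [exact: cvg_id|exact: cvg_cst].
Qed.

Lemma poisson_ge0 (e y x : R) : 0 < e -> 0 <= poisson e y x.
Proof.
move=> e0; rewrite mulr_ge0 ?invr_ge0 ?pi_ge0// divr_ge0 ?(ltW e0)//.
by rewrite addr_ge0 ?sqr_ge0.
Qed.

Lemma integral_poisson (e y : R) : 0 < e ->
  (\int[mu]_x (poisson e y x)%:E = 1)%E.
Proof.
move=> e0; have mp := measurable_poisson y e0.
rewrite ge0_integral_halflines//; last by move=> x; exact: poisson_ge0.
have mK z : measurable_fun (`[0, +oo[ : set R) (fun x : R =>
  (e / (e ^+ 2 + (x - z) ^+ 2))%:E).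
  have := measurable_poisson z e0 =>
    /(measurable_funM (@measurable_cst _ _ _ _ setT (pi : R))) h.
  apply/measurable_EFinP; apply: measurable_funTS;
    apply: eq_measurable_fun h => x _ /=.
  by rewrite /poisson mulVKf// gt_eqF// pi_gt0.
have h1 : (\int[mu]_(x in `[0%R, +oo[) (poisson e y x)%:E =
  (pi^-1 * (pi / 2 - atan (- y / e)))%:E)%E.
  rewrite EFinM -poisson_half// -ge0_integralZl//.
  - exact: mK.
  - by move=> x _; rewrite lee_fin divr_ge0 ?(ltW e0)// addr_ge0 ?sqr_ge0.
  - by rewrite lee_fin invr_ge0 pi_ge0.
have h2 : (\int[mu]_(x in `[0%R, +oo[) (poisson e y (- x))%:E =
  (pi^-1 * (pi / 2 - atan (y / e)))%:E)%E.
  rewrite -[y in atan (y / e)]opprK EFinM -poisson_half// -ge0_integralZl//.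
  - apply: eq_integral => x _; rewrite /poisson -EFinM.
    by rewrite (_ : (- x - y) ^+ 2 = (x - - y) ^+ 2)//; ring.
  - exact: mK.
  - by move=> x _; rewrite lee_fin divr_ge0 ?(ltW e0)// addr_ge0 ?sqr_ge0.
  - by rewrite lee_fin invr_ge0 pi_ge0.
rewrite h1 h2 -EFinD mulNr atanN; congr EFin.
have p0 : pi != 0 :> R by rewrite gt_eqF// pi_gt0.
rewrite -mulrDr; set A := atan _.
by have -> : pi / 2 - - A + (pi / 2 - A) = pi; [field|rewrite mulVf].
Qed.

Lemma integrable_poisson (e y : R) : 0 < e ->
  mu.-integrable setT (EFin \o poisson e y).
Proof.
move=> e0; apply: ge0_integrable; first exact: measurable_poisson.
  by move=> x; exact: poisson_ge0.
by rewrite integral_poisson// ltry.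
Qed.

Lemma Rintegral_poisson (e y : R) : 0 < e -> \int[mu]_x poisson e y x = 1.
Proof. by move=> e0; rewrite /Rintegral integral_poisson. Qed.

(** The real part of [e^(- i th) g w e^(i y w)] for [g = a + i b]. *)
Definition modulate_re (a b : R -> R) (y th w : R) : R :=
  a w * cos (y * w - th) - b w * sin (y * w - th).

Section inversion.
Variables (f1 f2 g1 g2 : R -> R) (sigma : R).
Let kap : R := (Num.sqrt (2 * pi))^-1.
(** The real part of the Fourier transform of [f1 + i f2] truncated to
[[-T, T]]; [trunc_im] is its imaginary part. *)
Definition trunc_re T w :=
  kap * \int[mu]_(x in `[- T, T]) (f1 x * cos (x * w) + f2 x * sin (x * w)).
Definition trunc_im T w :=
  kap * \int[mu]_(x in `[- T, T]) (f2 x * cos (x * w) - f1 x * sin (x * w)).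
Definition transform (v : R -> R) T y th w :=
  \int[mu]_(x in `[- T, T]) (v x * cos ((y - x) * w - th)).

Lemma integrable_cont_segment (v : R -> R) T : continuous v ->
  mu.-integrable `[- T, T] (EFin \o v).
Proof.
move=> cv; apply: continuous_compact_integrable; first exact: segment_compact.
exact: continuous_subspaceT.
Qed.

Lemma integrable_patch (v : R -> R) T : continuous v ->
  mu.-integrable setT (EFin \o (v \_ `[- T, T])).
Proof.
move=> cv; rewrite -restrict_EFin.
apply: (iffLR (@integrable_mkcond _ _ _ mu `[- T, T] (EFin \o v) _)) => //.
exact: integrable_cont_segment.
Qed.

Lemma patch_Rintegral (v c : R -> R) (T : R) :
  \int[mu]_(x in `[- T, T]) (v x * c x) = \int[mu]_x ((v \_ `[- T, T]) x * c x).
Proof.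
rewrite Rintegral_mkcond; apply: eq_Rintegral => x _.
by rewrite !patchE; case: ifP => // _; rewrite mul0r.
Qed.

Lemma continuous_cos_sub y w t :
  continuous (fun x : R => cos ((y - x) * w - t)).
Proof.
move=> x; apply: continuous_comp; last exact: continuous_cos.
apply: cvgB; last exact: cvg_cst.
by apply: cvgM; [apply: cvgB; [exact: cvg_cst|exact: cvg_id]|exact: cvg_cst].
Qed.

Lemma continuous_cos_scale w : continuous (fun x : R => cos (x * w)).
Proof.
move=> x; apply: continuous_comp; last exact: continuous_cos.
by apply: cvgM; [exact: cvg_id|exact: cvg_cst].
Qed.

Lemma continuous_sin_scale w : continuous (fun x : R => sin (x * w)).
Proof.
move=> x; apply: continuous_comp; last exact: continuous_sin.
by apply: cvgM; [exact: cvg_id|exact: cvg_cst].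
Qed.

Hypotheses (cf1 : continuous f1) (cf2 : continuous f2).

(** The product of [e^(i y w - i th)] and [e^(- i x w)] is recombined under the
integral, which leaves cosines of [(y - x) w] only: the sine is a cosine with
another phase. *)
Lemma trunc_transform T y th w :
  modulate_re (trunc_re T) (trunc_im T) y th w =
  kap * (transform f1 T y th w + transform f2 T y (th - pi / 2) w).
Proof.
have c1 := @continuous_cos_scale w; have c2 := @continuous_sin_scale w.
have iA : mu.-integrable `[- T, T]
  (EFin \o (fun x => f1 x * cos (x * w) + f2 x * sin (x * w))).
  apply: integrable_cont_segment => x.
  by apply: cvgD; apply: cvgM; [exact: cf1|exact: c1|exact: cf2|exact: c2].
have iB : mu.-integrable `[- T, T]
  (EFin \o (fun x => f2 x * cos (x * w) - f1 x * sin (x * w))).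
  apply: integrable_cont_segment => x.
  by apply: cvgB; apply: cvgM; [exact: cf2|exact: c1|exact: cf1|exact: c2].
have iC (v : R -> R) t : continuous v ->
  mu.-integrable `[- T, T] (EFin \o (fun x => v x * cos ((y - x) * w - t))).
  move=> cv; apply: integrable_cont_segment => x.
  by apply: cvgM; [exact: cv|exact: (@continuous_cos_sub y w t)].
rewrite /modulate_re /trunc_re /trunc_im -!mulrA -mulrBr; congr (_ * _).
rewrite -!RintegralZr// -RintegralB//; last 2 first.
- by have := @integrableZr _ _ _ mu _ _ (cos (y * w - th)) _ iA; apply.
- by have := @integrableZr _ _ _ mu _ _ (sin (y * w - th)) _ iB; apply.
rewrite /transform -RintegralD//; last 2 first.
- exact: iC.
- exact: iC.
apply: eq_Rintegral => x _.
have -> : (y - x) * w - (th - pi / 2) = ((y - x) * w - th) + pi / 2 by ring.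
rewrite cosDpihalf (_ : (y - x) * w - th = (y * w - th) - x * w); last by ring.
move: (y * w - th) => A; rewrite cosB sinB; ring.
Qed.

Lemma transformE v T y th w : transform v T y th w =
  \int[mu]_x ((v \_ `[- T, T]) x * cos ((y - x) * w - th)).
Proof. exact: patch_Rintegral. Qed.

Lemma integrable_exp_transform v T y th e : continuous v -> 0 < e ->
  mu.-integrable setT (EFin \o (fun w =>
    expR (- (e * `|w|)) * transform v T y th w)).
Proof.
move=> cv e0; have :=
  integrable_expabs_transform y th (integrable_patch T cv) e0.
by apply: eq_integrable => // w _ /=; rewrite transformE.
Qed.

(** Modulation by the trivial phase at [y = 0] gives back the real part. *)
Lemma measurable_trunc_re T : measurable_fun setT (trunc_re T).
Proof.
have h (v : R -> R) th : continuous v ->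
  measurable_fun setT (fun w => transform v T 0 th w).
  move=> cv; have := measurable_transform 0 th (integrable_patch T cv) ltr01.
  by apply: eq_measurable_fun => w _; rewrite transformE.
have := measurable_funM (@measurable_cst _ _ _ _ setT kap)
  (measurable_funD (h f1 0 cf1) (h f2 (- (pi / 2)) cf2)).
apply: eq_measurable_fun => w _.
have := @trunc_transform T 0 0 w.
by rewrite /modulate_re mul0r subr0 cos0 sin0 mulr1 mulr0 subr0 sub0r => ->.
Qed.

(** Modulation by the phase [pi / 2] at [y = 0] gives the imaginary part. *)
Lemma measurable_trunc_im T : measurable_fun setT (trunc_im T).
Proof.
have h (v : R -> R) th : continuous v ->
  measurable_fun setT (fun w => transform v T 0 th w).
  move=> cv; have := measurable_transform 0 th (integrable_patch T cv) ltr01.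
  by apply: eq_measurable_fun => w _; rewrite transformE.
have := measurable_funM (@measurable_cst _ _ _ _ setT kap)
  (measurable_funD (h f1 (pi / 2) cf1) (h f2 (pi / 2 - (pi / 2)) cf2)).
apply: eq_measurable_fun => w _.
have := @trunc_transform T 0 (pi / 2) w.
by rewrite /modulate_re mul0r sub0r cosN sinN cos_pihalf sin_pihalf mulr0 mulrN1
  opprK add0r => ->.
Qed.

Lemma poisson_le_inv e y x : 0 < e -> poisson e y x <= e^-1.
Proof.
move=> e0; rewrite /poisson.
have p1 : pi^-1 <= 1 :> R by rewrite invf_le1 ?pi_gt0//
  (le_trans _ (pi_ge2 R))// ler1n.
have ep : 0 < e ^+ 2 + (x - y) ^+ 2 by rewrite ltr_pwDl ?sqr_ge0// exprn_gt0.
have h : e / (e ^+ 2 + (x - y) ^+ 2) <= e^-1.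
  rewrite ler_pdivrMr// mulrDr expr2 mulKf ?gt_eqF// lerDl mulr_ge0 ?sqr_ge0//
    invr_ge0 ltW//.
rewrite -[leRHS]mul1r ler_pM ?invr_ge0 ?pi_ge0// divr_ge0 ?(ltW e0)// ltW//.
Qed.

Lemma integrable_patch_poisson (v : R -> R) T y e : continuous v -> 0 < e ->
  mu.-integrable setT (EFin \o (fun x => (v \_ `[- T, T]) x * poisson e y x)).
Proof.
move=> cv e0; have ip := integrable_patch T cv.
apply: (@integrable_dominated setT _ (fun x => e^-1 * `|(v \_ `[- T, T]) x|)) =>
  //.
- apply: measurable_funM; last exact: measurable_poisson.
  by apply/measurable_EFinP; exact: measurable_int ip.
- by apply: integrableZR => //; exact: integrable_norm.
move=> x _; rewrite normrM mulrC ler_wpM2r// ger0_norm ?poisson_ge0//.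
exact: poisson_le_inv.
Qed.

Lemma kap2 : kap ^+ 2 = (2 * pi)^-1.
Proof. by rewrite /kap exprVn sqr_sqrtr// mulr_ge0// pi_ge0. Qed.

(** Abel means of the inverse transform of the truncated function are its
Poisson means. *)
Lemma trunc_poisson T y th e : 0 < e ->
  kap * \int[mu]_w (expR (- (e * `|w|)) *
    modulate_re (trunc_re T) (trunc_im T) y th w) =
  \int[mu]_x (((fun x => f1 x * cos th + f2 x * sin th) \_ `[- T, T]) x *
    poisson e y x).
Proof.
move=> e0.
have p0 : pi != 0 :> R by rewrite gt_eqF// pi_gt0.
under eq_Rintegral =>
  w _ do rewrite trunc_transform mulrCA [X in kap * X]mulrDr.
have it1 := integrable_exp_transform T y th cf1 e0.
have it2 := integrable_exp_transform T y (th - pi / 2) cf2 e0.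
rewrite RintegralZl//; last exact: integrableDR.
rewrite RintegralD//.
have E (v : R -> R) t : continuous v ->
  \int[mu]_w (expR (- (e * `|w|)) * transform v T y t w) =
  2 * pi * cos t * \int[mu]_x ((v \_ `[- T, T]) x * poisson e y x).
  move=> cv; under eq_Rintegral => w _ do rewrite transformE.
  rewrite Rintegral_expabs_transform//; last exact: integrable_patch.
  rewrite -RintegralZl//; last exact: integrable_patch_poisson.
  apply: eq_Rintegral => x _;
    rewrite /poisson (_ : (x - y) ^+ 2 = (y - x) ^+ 2); last by ring.
  have ep : e ^+ 2 + (y - x) ^+ 2 != 0 by rewrite gt_eqF// ltr_pwDl ?sqr_ge0//
    exprn_gt0.
  move: ep; set D := e ^+ 2 + _ => ep.
  rewrite (_ : 2 * pi * cos t * _ =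
    (pi / pi) * ((v \_ `[- T, T]) x * (2 * e * cos t / D))); last by ring.
  by rewrite divff// mul1r.
have -> : \int[mu]_x
  (((fun x => f1 x * cos th + f2 x * sin th) \_ `[- T, T]) x * poisson e y x) =
  \int[mu]_x (cos th * ((f1 \_ `[- T, T]) x * poisson e y x) +
    sin th * ((f2 \_ `[- T, T]) x * poisson e y x)).
  apply: eq_Rintegral => x _; rewrite !patchE; case: ifP => _;
    last by rewrite !mul0r !mulr0 addr0.
  ring.
have ip1 := integrable_patch_poisson T y cf1 e0.
have ip2 := integrable_patch_poisson T y cf2 e0.
rewrite RintegralD//; last 2 first.
- exact: integrableZR.
- exact: integrableZR.
rewrite !RintegralZl// !E//
  cosB cos_pihalf sin_pihalf mulr0 mulr1 add0r mulrA -expr2 kap2.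
rewrite (_ : _^-1 * _ =
  ((2 * pi)^-1 * (2 * pi)) *
  (cos th * \int[mu]_x ((f1 \_ `[- T, T]) x * poisson e y x) +
  sin th * \int[mu]_x ((f2 \_ `[- T, T]) x * poisson e y x))); last by ring.
by rewrite mulVf ?mul1r// mulf_neq0.
Qed.

Hypotheses (mg1 : measurable_fun setT g1) (mg2 : measurable_fun setT g2).
Hypotheses (gsupp : forall w, sigma < `|w| -> g1 w = 0 /\ g2 w = 0).
Hypothesis (gL2 : (\int[mu]_w (g1 w ^+ 2 + g2 w ^+ 2)%:E < +oo)%E).

Let msq (a : R -> R) : measurable_fun setT a ->
  measurable_fun setT (fun w => a w ^+ 2).
Proof. by move=> ma; under eq_fun do rewrite expr2; exact: measurable_funM. Qed.

(** Square integrable functions with bounded support are integrable, by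
[|a| <= a^2 + 1 / 4] on the support. *)
Lemma integrable_gabs :
  mu.-integrable setT (EFin \o (fun w => `|g1 w| + `|g2 w|)).
Proof.
have ig : mu.-integrable setT (EFin \o (fun w => g1 w ^+ 2 + g2 w ^+ 2)).
  apply: ge0_integrable => //; first by apply: measurable_funD; exact: msq.
  by move=> w; rewrite addr_ge0 ?sqr_ge0.
have ii : mu.-integrable setT
  (EFin \o (\1_(`[- sigma, sigma] : set R) : R -> R)).
  exact: integrable_indic_itv.
apply: (@integrable_dominated setT _ (fun w =>
  (g1 w ^+ 2 + g2 w ^+ 2) + \1_(`[- sigma, sigma] : set R) w)) => //.
- by apply: measurable_funD; exact: measurableT_comp.
- exact: integrableDR.
move=> w _; rewrite ger0_norm ?addr_ge0//.
have [ws|ws] := leP `|w| sigma; last first.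
  by have [-> ->] := gsupp ws; rewrite normr0 expr0n/= !add0r.
rewrite indicE mem_set/=; last by rewrite in_itv/= -ler_norml.
have h (a : R) : `|a| <= a ^+ 2 + 1 / 4.
  rewrite -[a ^+ 2]real_normK ?num_real// -subr_ge0.
  have -> : `|a| ^+ 2 + 1 / 4 - `|a| = (`|a| - 1 / 2) ^+ 2 by field.
  exact: sqr_ge0.
have := h (g1 w); have := h (g2 w); lra.
Qed.

Lemma modulate_re_le y th w : `|modulate_re g1 g2 y th w| <= `|g1 w| + `|g2 w|.
Proof.
rewrite /modulate_re (le_trans (ler_normB _ _))// !normrM lerD// ler_piMr//
  ?cos_max ?sin_max//.
Qed.

Lemma measurable_modulate_re y th :
  measurable_fun setT (modulate_re g1 g2 y th).
Proof.
apply: measurable_funB; apply: measurable_funM => //.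
  exact: measurable_cos_affine.
exact: measurable_sin_affine.
Qed.

Lemma integrable_modulate_re y th :
  mu.-integrable setT (EFin \o modulate_re g1 g2 y th).
Proof.
apply: (@integrable_dominated setT _ _ _ _ integrable_gabs) => //;
  first exact: measurable_modulate_re.
by move=> w _; exact: modulate_re_le.
Qed.

(** On the support [1 - e^(- e |w|) <= e sigma]. *)
Lemma abel_error y th e : 0 < e ->
  `|\int[mu]_w (expR (- (e * `|w|)) * modulate_re g1 g2 y th w) -
    \int[mu]_w modulate_re g1 g2 y th w| <=
  e * (sigma * \int[mu]_w (`|g1 w| + `|g2 w|)).
Proof.
move=> e0; have ig := integrable_modulate_re y th.
have ieg : mu.-integrable setT
  (EFin \o (fun w => expR (- (e * `|w|)) * modulate_re g1 g2 y th w)).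
  under eq_fun do rewrite mulrC; apply: integrable_boundedM => //;
    first exact: measurable_expabs.
  by move=> w; rewrite ger0_norm ?expR_ge0// expabs_le1.
rewrite -RintegralB// -!RintegralZl//; last 2 first.
- by apply: integrableZR => //; exact: integrable_gabs.
- exact: integrable_gabs.
apply: normr_Rintegral_le => //.
- exact: integrableBR.
- by do 2 apply: integrableZR => //; exact: integrable_gabs.
move=> w _; have [ws|ws] := leP `|w| sigma; last first.
  by rewrite /modulate_re; have [-> ->] := gsupp ws;
    rewrite !mul0r subr0 mulr0 subr0 normr0 addr0 !mulr0.
rewrite -{2}[modulate_re g1 g2 y th w]mul1r -mulrBl normrM mulrA ler_pM//
  ?modulate_re_le//.
rewrite ler0_norm ?subr_le0 ?expabs_le1// opprB lerBlDr -lerBlDl.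
apply: le_trans (expR_ge1Dx _); rewrite lerD2l lerN2 ler_pM2l//.
Qed.

Definition trunc_sqdist T w :=
  (g1 w - trunc_re T w) ^+ 2 + (g2 w - trunc_im T w) ^+ 2.

Lemma measurable_trunc_sqdist T : measurable_fun setT (trunc_sqdist T).
Proof.
apply: measurable_funD; apply: msq; apply: measurable_funB => //.
  exact: measurable_trunc_re.
exact: measurable_trunc_im.
Qed.

Lemma trunc_sqdist_ge0 T w : 0 <= trunc_sqdist T w.
Proof. by rewrite addr_ge0 ?sqr_ge0. Qed.

(** Passing to the [L^2] limit.  Instead of the Cauchy-Schwarz inequality, the
inequality [|a b| <= (e^2 a^2 + b^2 / e^2) / 2] is integrated, with [a] the
damping factor, whose square has integral [1 / e]. *)
Lemma truncation_error T y th e : 0 < e ->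
  (\int[mu]_w (trunc_sqdist T w)%:E < (e ^+ 3)%:E)%E ->
  `|\int[mu]_w (expR (- (e * `|w|)) * modulate_re g1 g2 y th w) -
    \int[mu]_w (expR (- (e * `|w|)) *
    modulate_re (trunc_re T) (trunc_im T) y th w)| <= e.
Proof.
move=> e0 De.
have iD : mu.-integrable setT (EFin \o trunc_sqdist T).
  apply: ge0_integrable;
    [exact: measurable_trunc_sqdist|exact: trunc_sqdist_ge0|].
  exact: lt_trans De (ltry _).
have ieg : mu.-integrable setT
  (EFin \o (fun w => expR (- (e * `|w|)) * modulate_re g1 g2 y th w)).
  have ig := integrable_modulate_re y th.
  under eq_fun do rewrite mulrC; apply: integrable_boundedM => //;
    first exact: measurable_expabs.
  by move=> w; rewrite ger0_norm ?expR_ge0// expabs_le1.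
have iet : mu.-integrable setT (EFin \o (fun w => expR (- (e * `|w|)) *
    modulate_re (trunc_re T) (trunc_im T) y th w)).
  under eq_fun => w do rewrite trunc_transform mulrCA [X in kap * X]mulrDr.
  apply: integrableZR => //; apply: integrableDR => //;
    exact: integrable_exp_transform.
rewrite -RintegralB//.
have e20 : 0 < 2 * e by rewrite mulr_gt0.
have ib : mu.-integrable setT
  (EFin \o (fun w =>
  (e ^+ 2 / 2) * expR (- (2 * e * `|w|)) + (2 * e ^+ 2)^-1 * trunc_sqdist T w)).
  by apply: integrableDR => //; apply: integrableZR => //;
    exact: integrable_expabs.
apply: (@le_trans _ _
  (\int[mu]_w ((e ^+ 2 / 2) * expR (- (2 * e * `|w|)) +
  (2 * e ^+ 2)^-1 * trunc_sqdist T w))).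
  apply: normr_Rintegral_le => //; first exact: integrableBR.
  move=> w _; rewrite -mulrBr /modulate_re.
  set C := cos _; set S := sin _.
  have CS : C ^+ 2 + S ^+ 2 = 1 by exact: cos2Dsin2.
  have -> : expR (- (2 * e * `|w|)) = expR (- (e * `|w|)) ^+ 2.
    by rewrite expr2 -expRD; congr expR; ring.
  set a := expR _.
  set d1 := g1 w - trunc_re T w; set d2 := g2 w - trunc_im T w.
  have -> : g1 w * C - g2 w * S - (trunc_re T w * C - trunc_im T w * S) =
    d1 * C - d2 * S.
    by rewrite /d1 /d2; ring.
  have -> : trunc_sqdist T w = (d1 * C - d2 * S) ^+ 2 + (d1 * S + d2 * C) ^+ 2.
    have -> : (d1 * C - d2 * S) ^+ 2 + (d1 * S + d2 * C) ^+ 2 =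
      (d1 ^+ 2 + d2 ^+ 2) * (C ^+ 2 + S ^+ 2) by ring.
    by rewrite CS mulr1.
  set b := d1 * C - d2 * S; set b' := d1 * S + d2 * C.
  have e2 : 0 < e ^+ 2 by rewrite exprn_gt0.
  have h1 : 0 <= (2 * e ^+ 2)^-1 * b' ^+ 2.
    by rewrite mulr_ge0 ?sqr_ge0// invr_ge0 mulr_ge0// ltW.
  have hs (q : R) : 0 <= (e * a + q) ^+ 2 by exact: sqr_ge0.
  clearbody b b'; rewrite mulrDr addrA;
    apply: (@le_trans _ _ (e ^+ 2 / 2 * a ^+ 2 + (2 * e ^+ 2)^-1 * b ^+ 2));
    last by rewrite lerDl.
  rewrite ler_norml; apply/andP; split; rewrite -subr_ge0.
    rewrite (_ : _ - _ = (e * a + b / e) ^+ 2 / 2); last by field;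
      rewrite gt_eqF.
    by rewrite divr_ge0.
  rewrite (_ : _ - _ = (e * a + - b / e) ^+ 2 / 2); last by field;
    rewrite gt_eqF.
  by rewrite divr_ge0.
rewrite RintegralD//; last 2 first.
- by apply: integrableZR => //; exact: integrable_expabs.
- exact: integrableZR.
rewrite !RintegralZl//; last exact: integrable_expabs.
rewrite Rintegral_expabs//.
have DD : \int[mu]_w trunc_sqdist T w <= e ^+ 3.
  rewrite -lee_fin /Rintegral fineK; last by apply: integrable_fin_num.
  exact: ltW.
have h : (2 * e ^+ 2)^-1 * \int[mu]_w trunc_sqdist T w <=
  (2 * e ^+ 2)^-1 * e ^+ 3.
  by rewrite ler_wpM2l// invr_ge0 mulr_ge0// exprn_ge0// ltW.
apply: le_trans (lerD (lexx _) h) _.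
by rewrite (_ : _ + _ = e)//; field; rewrite gt_eqF.
Qed.

End inversion.

(** Within distance [d] of [y] continuity is used. Further away the kernel is at
most [e^2 / d^2], and it is dominated by [(2 e^2 / d) * poisson d y], which
bounds its mass there, while the contribution of [U], only square integrable, is
controlled by [|U| q <= (e U^2 + q^2 / e) / 2]. The parameter of the kernel is
[e^2] to leave room for the weight [e] in this inequality. *)
Lemma poisson_approx (U : R -> R) (y d eta e T M : R) :
  continuous U -> mu.-integrable setT (EFin \o (fun x => U x ^+ 2)) ->
  \int[mu]_x U x ^+ 2 <= M ->
  0 < d <= 1 -> 0 < eta -> 0 < e -> `|y| + 1 <= T ->
  (forall x, `|x - y| < d -> `|U x - U y| <= eta) ->
  `|\int[mu]_x ((U \_ `[- T, T]) x * poisson (e ^+ 2) y x) - U y| <=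
   eta + (e / 2 * M + e / 2 / d ^+ 2 + `|U y| * (2 * e ^+ 2 / d)).
Proof.
move=> cU iU UM /andP[d0 d1] eta0 e0 yT hU.
have e20 : 0 < e ^+ 2 by rewrite exprn_gt0.
have iq := integrable_poisson y e20.
have iUq := integrable_patch_poisson T y cU e20.
have Uy : U y = U y *
  \int[mu]_x poisson (e ^+ 2) y x by rewrite Rintegral_poisson// mulr1.
rewrite [X in _ - X]Uy -RintegralZl// -RintegralB//; last exact: integrableZR.
(* the integrable majorant, valid near [y] and away from it *)
pose B x := (eta + e / 2 / d ^+ 2) * poisson (e ^+ 2) y x + e / 2 * U x ^+ 2 +
  `|U y| * (2 * e ^+ 2 / d) * poisson d y x.
have ip := integrable_poisson y d0.
have i1 : mu.-integrable setT
  (EFin \o (fun x => (eta + e / 2 / d ^+ 2) * poisson (e ^+ 2) y x)).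
  exact: integrableZR.
have i2 : mu.-integrable setT (EFin \o (fun x => e / 2 * U x ^+ 2)) by exact:
  integrableZR.
have i3 : mu.-integrable setT
  (EFin \o (fun x => `|U y| * (2 * e ^+ 2 / d) * poisson d y x)).
  exact: integrableZR.
have i12 : mu.-integrable setT
  (EFin \o (fun x => (eta + e / 2 / d ^+ 2) * poisson (e ^+ 2) y x +
  e / 2 * U x ^+ 2)) by exact: integrableDR.
have iB : mu.-integrable setT (EFin \o B) by exact: integrableDR.
apply: (@le_trans _ _ (\int[mu]_x B x)); last first.
  rewrite /B RintegralD// RintegralD//.
  rewrite (@RintegralZl _ _ _ mu setT (poisson (e ^+ 2) y))//.
  rewrite (@RintegralZl _ _ _ mu setT (poisson d y))//.
  rewrite (@RintegralZl _ _ _ mu setT (fun x => U x ^+ 2))//.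
  rewrite !Rintegral_poisson// !mulr1.
  have : e / 2 * \int[mu]_x U x ^+ 2 <= e / 2 * M by rewrite ler_wpM2l//
    divr_ge0// ltW.
  lra.
apply: normr_Rintegral_le => //; first by apply: integrableBR => //;
  exact: integrableZR.
move=> x _; rewrite /B -mulrBl normrM.
set q := poisson (e ^+ 2) y x; have q0 : 0 <= q by exact: poisson_ge0.
have qd0 : 0 <= poisson d y x by exact: poisson_ge0.
rewrite [`|q|]ger0_norm//.
have ed : 0 <= e / 2 / d ^+ 2 by rewrite !divr_ge0 ?exprn_ge0// ltW.
have t3 : 0 <= `|U y| * (2 * e ^+ 2 / d) * poisson d y x.
  apply: mulr_ge0 => //; apply: mulr_ge0 => //; apply: divr_ge0;
    last exact: ltW.
  by apply: mulr_ge0 => //; exact: ltW.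
have t2 : 0 <= e / 2 * U x ^+ 2 by rewrite mulr_ge0 ?sqr_ge0// divr_ge0// ltW.
have [xy|xy] := ltP `|x - y| d.
  have xT : x \in (`[- T, T]%classic : set R).
    rewrite inE/= in_itv/= -ler_norml.
    have := ler_normD (x - y) y; rewrite subrK; lra.
  rewrite patchE xT.
  have := ler_wpM2r q0 (hU x xy).
  have : 0 <= e / 2 / d ^+ 2 * q by rewrite mulr_ge0.
  lra.
have dxy : d ^+ 2 <= (x - y) ^+ 2.
  by rewrite -[leRHS]real_normK ?num_real// ler_pXn2r ?nnegrE// ltW.
have d20 : 0 < d ^+ 2 by rewrite exprn_gt0.
have D0 : 0 < (e ^+ 2) ^+ 2 + (x - y) ^+ 2 by rewrite ltr_pwDl ?sqr_ge0//
  exprn_gt0.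
have D1 : 0 < d ^+ 2 + (x - y) ^+ 2 by rewrite ltr_pwDl ?sqr_ge0.
have pi0 : 0 < pi^-1 :> R by rewrite invr_gt0 pi_gt0.
have hq2 : q <= 2 * e ^+ 2 / d * poisson d y x.
  rewrite /q (_ : _ * poisson d y x =
    pi^-1 * (e ^+ 2 * (2 / (d ^+ 2 + (x - y) ^+ 2)))); last first.
    rewrite /poisson; move: D1; set D := d ^+ 2 + _ => D1.
    rewrite (_ : 2 * _ / d * _ = (d / d) * (pi^-1 * (e ^+ 2 * (2 / D))));
      last by ring.
    by rewrite divff ?mul1r// gt_eqF.
  rewrite /poisson ler_pM2l//.
  rewrite ler_pM2l// ler_pdivlMr// mulrC ler_pdivrMr//.
  have := sqr_ge0 (e ^+ 2); lra.
have hq1 : q <= e ^+ 2 / d ^+ 2.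
  rewrite /q /poisson -[leRHS]mul1r ler_pM//.
  - exact: ltW.
  - by rewrite divr_ge0// ltW.
  - by rewrite invf_le1 ?pi_gt0// (le_trans _ (pi_ge2 R))// ler1n.
  - rewrite ler_pM2l// lef_pV2 ?posrE//.
    have := sqr_ge0 (e ^+ 2); lra.
have hU1 : `|(U \_ `[- T, T]) x| * q <= e / 2 * U x ^+ 2 + e / 2 / d ^+ 2 * q.
  have hp : `|(U \_ `[- T, T]) x| <= `|U x|.
    by rewrite patchE; case: ifP => _ //; rewrite normr0.
  apply: (le_trans (ler_wpM2r q0 hp)).
  have hqq : q ^+ 2 / (2 * e) <= e / 2 / d ^+ 2 * q.
    rewrite expr2 mulrC mulrA [leRHS]mulrC mulrC ler_wpM2l//.
    rewrite mulrC ler_pdivrMr ?mulr_gt0//; apply: le_trans hq1 _.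
    by rewrite (_ : e / 2 / d ^+ 2 * (2 * e) = e ^+ 2 / d ^+ 2)//; field;
      rewrite gt_eqF.
  apply: le_trans (lerD (lexx _) hqq).
  rewrite -[U x ^+ 2]real_normK ?num_real// -subr_ge0.
  rewrite (_ : _ - _ = (e * `|U x| - q) ^+ 2 / (2 * e)); last by field;
    rewrite gt_eqF.
  by rewrite divr_ge0 ?sqr_ge0// mulr_ge0// ltW.
have hU2 : `|U y| * q <= `|U y| * (2 * e ^+ 2 / d) * poisson d y x.
  by rewrite -mulrA ler_wpM2l.
have := ler_wpM2r q0 (ler_normB ((U \_ `[- T, T]) x) (U y)); rewrite mulrDl.
have : 0 <= eta * q by rewrite mulr_ge0// ltW.
lra.
Qed.

(** For a given tolerance, [T] is chosen after the damping parameter, so that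
the truncation error is negligible; no limit in [T] alone has to be taken on the
side of the function. *)
Lemma fourier_inversion (f1 f2 g1 g2 : R -> R) (sigma : R) :
  continuous f1 -> continuous f2 ->
  measurable_fun setT g1 -> measurable_fun setT g2 ->
  0 <= sigma -> (forall w, sigma < `|w| -> g1 w = 0 /\ g2 w = 0) ->
  (\int[mu]_x (f1 x ^+ 2 + f2 x ^+ 2)%:E < +oo)%E ->
  (\int[mu]_w (g1 w ^+ 2 + g2 w ^+ 2)%:E < +oo)%E ->
  (forall e, 0 < e -> exists T0, forall T, T0 <= T ->
    (\int[mu]_w (trunc_sqdist f1 f2 g1 g2 T w)%:E < e%:E)%E) ->
  forall y th, f1 y * cos th + f2 y * sin th =
    (Num.sqrt (2 * pi))^-1 * \int[mu]_w modulate_re g1 g2 y th w.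
Proof.
move=> cf1 cf2 mg1 mg2 s0 gs fL2 gL2 conv y th.
set kap := (Num.sqrt (2 * pi))^-1.
have kap0 : 0 < kap by rewrite invr_gt0 sqrtr_gt0 mulr_gt0// pi_gt0.
pose U x := f1 x * cos th + f2 x * sin th.
have cU : continuous U.
  by move=> x; apply: cvgD; apply: cvgM;
    [exact: cf1|exact: cvg_cst|exact: cf2|exact: cvg_cst].
have mf (f : R -> R) : continuous f -> measurable_fun setT (fun x => f x ^+ 2).
  move=> cf; apply: continuous_measurable_fun => x.
  by apply: (@continuous_comp _ _ _ f (fun x => x ^+ 2));
    [exact: cf|exact: exprn_continuous].
have iff2 : mu.-integrable setT (EFin \o (fun x => f1 x ^+ 2 + f2 x ^+ 2)).
  apply: ge0_integrable => //; first by apply: measurable_funD; exact: mf.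
  by move=> x; rewrite addr_ge0 ?sqr_ge0.
have iU : mu.-integrable setT (EFin \o (fun x => U x ^+ 2)).
  apply: (integrable_dominated _ _ iff2) => //; first exact: mf.
  move=> x _; rewrite ger0_norm ?sqr_ge0// -subr_ge0.
  have -> : f1 x ^+ 2 + f2 x ^+ 2 =
    (f1 x ^+ 2 + f2 x ^+ 2) * (cos th ^+ 2 + sin th ^+ 2).
    by rewrite cos2Dsin2 mulr1.
  rewrite (_ : _ - _ = (f1 x * sin th - f2 x * cos th) ^+ 2);
    first exact: sqr_ge0.
  by rewrite /U; ring.
set Q := kap * _.
pose M := \int[mu]_x U x ^+ 2.
have M0 : 0 <= M by apply: Rintegral_ge0 => x _; exact: sqr_ge0.
pose G := \int[mu]_w (`|g1 w| + `|g2 w|).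
have G0 : 0 <= G by apply: Rintegral_ge0 => x _; rewrite addr_ge0.
suff main eta : 0 < eta -> `|U y - Q| <= 2 * eta.
  apply/eqP; rewrite -subr_eq0 -normr_le0 -/(U y); apply/ler_addgt0Pr => e e0.
  by rewrite add0r (le_trans (main (e / 2) _)) ?divr_gt0//; lra.
move=> eta0.
have [d [d0 d1] hU] : exists2 d, 0 < d /\ d <= 1 & forall x, `|x - y| < d ->
  `|U x - U y| <= eta.
  have /cvgrPdist_le /(_ eta eta0) := cU y.
  move=> /nbhs_ballP[d /= d0 hd]; exists (Num.min d 1);
    first by rewrite lt_min d0 ltr01 ge_min lexx orbT.
  move=> x; rewrite lt_min => /andP[xd _]; rewrite distrC; apply: hd => /=.
  by rewrite /ball/= distrC.
pose K := M / 2 + (2 * d ^+ 2)^-1 + `|U y| * (2 / d) + kap + kap * (sigma * G).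
have K0 : 0 <= K.
  rewrite /K !addr_ge0// ?(ltW kap0)//.
  - by rewrite divr_ge0.
  - by rewrite invr_ge0 mulr_ge0// sqr_ge0.
  - by rewrite mulr_ge0// divr_ge0// ltW.
  - by apply: mulr_ge0; [exact: ltW|exact: mulr_ge0].
suff est ep : 0 < ep <= 1 -> `|U y - Q| <= eta + ep * K.
  pose ep := Num.min 1 (eta / (K + 1)).
  have K1 : 0 < K + 1 by rewrite ltr_wpDl.
  have ep0 : 0 < ep by rewrite lt_min ltr01 divr_gt0.
  have ep1 : ep <= 1 by rewrite ge_min lexx.
  have epK : ep <= eta / (K + 1) by rewrite ge_min lexx orbT.
  apply: (le_trans (est ep _)); first by rewrite ep0.
  have : ep * K <= eta / (K + 1) * K by rewrite ler_wpM2r.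
  have : eta / (K + 1) * K <= eta by rewrite mulrAC ler_pdivrMr// ler_pM2l//
    lerDl.
  lra.
move=> /andP[ep0 ep1].
have e20 : 0 < ep ^+ 2 by rewrite exprn_gt0.
have e2e : ep ^+ 2 <= ep by rewrite expr2 ler_piMr// ltW.
(* the cube is the precision that the truncation estimate requires *)
have [T0 hT0] := conv _ (exprn_gt0 3 e20).
pose T := Num.max T0 (`|y| + 1).
have DT := hT0 T; rewrite le_max lexx /= in DT; have {}DT := DT isT.
have yT : `|y| + 1 <= T by rewrite le_max lexx orbT.
have d01 : 0 < d <= 1 by rewrite d0.
have h1 := poisson_approx cU iU (lexx M) d01 eta0 ep0 yT hU.
have h2 := truncation_error cf1 cf2 mg1 mg2 gs gL2 y th e20 DT.
have h3 := abel_error mg1 mg2 gs gL2 y th e20.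
rewrite -(trunc_poisson cf1 cf2 T y th e20) -/kap in h1.
move: h1 h2 h3; rewrite -/G.
set I1 := \int[mu]_w (expR _ * modulate_re (trunc_re _ _ _) _ _ _ _).
set I2 := \int[mu]_w (expR _ * modulate_re g1 _ _ _ _).
set I3 := \int[mu]_w modulate_re _ _ _ _ _ => h1 h2 h3.
have -> : U y - Q = - (kap * I1 - U y) + - (kap * (I2 - I1)) + kap * (I2 - I3).
  by rewrite (_ : Q = kap * I3)//; ring.
apply: le_trans (ler_normD _ _) _;
  apply: le_trans (lerD (ler_normD _ _) (lexx _)) _.
rewrite !normrN !normrM (gtr0_norm kap0).
have k2 := ler_wpM2l (ltW kap0) h2; have k3 := ler_wpM2l (ltW kap0) h3.
apply: le_trans (lerD (lerD h1 k2) k3) _.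
have q1 : `|U y| * (2 * ep ^+ 2 / d) <= `|U y| * (ep * 2 / d).
  rewrite ler_wpM2l// ler_wpM2r ?invr_ge0 ?(ltW d0)// mulrC ler_wpM2r//.
have q2 : kap * ep ^+ 2 <= kap * ep by rewrite ler_wpM2l// ltW.
have q3 : kap * (ep ^+ 2 * (sigma * G)) <= kap * (ep * (sigma * G)).
  by rewrite ler_wpM2l ?(ltW kap0)// ler_wpM2r// mulr_ge0.
have -> : eta + ep * K =
  eta + (ep / 2 * M + ep / 2 / d ^+ 2 + `|U y| * (ep * 2 / d)) + kap * ep +
  kap * (ep * (sigma * G)).
  by rewrite /K; field; rewrite gt_eqF.
lra.
Qed.

End Rint.

(** * The native space of the inverse multiquadric *)

Section dual.
Variable R : realType.
Notation mu := (@lebesgue_measure R).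

Lemma Rintegral_sum (I : Type) (r : seq I) (F : I -> R -> R) :
  (forall i, mu.-integrable setT (EFin \o F i)) ->
  mu.-integrable setT (EFin \o (fun x => \sum_(i <- r) F i x)) /\
  \int[mu]_x (\sum_(i <- r) F i x) = \sum_(i <- r) \int[mu]_x F i x.
Proof.
move=> iF; elim: r => [|i r [IH1 IH2]].
  split; first by apply: (@eq_integrable _ _ _ mu _ _ (cst 0%E)) => // [x _|];
    rewrite /= ?big_nil//; exact: integrable0.
  rewrite big_nil; under eq_Rintegral do rewrite big_nil.
  by rewrite Rintegral_cst// mul0r.
have E x : \sum_(j <- i :: r) F j x =
  F i x + \sum_(j <- r) F j x by rewrite big_cons.
have i2 : mu.-integrable setT (EFin \o (fun x => F i x + \sum_(j <- r) F j x))
  by exact: integrableDR.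
split; first by apply: eq_integrable i2 => // x _ /=; rewrite E.
by under eq_Rintegral do rewrite E; rewrite RintegralD// IH2 big_cons.
Qed.

Variable c : R.
Hypothesis c0 : 0 < c.

Definition imq (y : R) := pi / Num.sqrt (c ^+ 2 + y ^+ 2).

(** Real part of [e^(- i th) \sum_i p_i e^(i y_i x)]; [sin_sum] is its imaginary
part. *)
Definition cos_sum m (p y : 'I_m -> R) th (x : R) :=
  \sum_(i < m) p i * cos (y i * x - th).
Definition sin_sum m (p y : 'I_m -> R) th (x : R) :=
  \sum_(i < m) p i * sin (y i * x - th).

(** A phase does not change the modulus. *)
Lemma trig_sum_phase m (p y : 'I_m -> R) th x :
  cos_sum p y th x ^+ 2 + sin_sum p y th x ^+ 2 =
    cos_sum p y 0 x ^+ 2 + sin_sum p y 0 x ^+ 2.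
Proof.
have -> : cos_sum p y th x =
  cos_sum p y 0 x * cos th + sin_sum p y 0 x * sin th.
  rewrite /cos_sum /sin_sum !mulr_suml -big_split/=; apply: eq_bigr => i _.
  by rewrite subr0 cosB; ring.
have -> : sin_sum p y th x =
  sin_sum p y 0 x * cos th - cos_sum p y 0 x * sin th.
  rewrite /cos_sum /sin_sum !mulr_suml -sumrB/=; apply: eq_bigr => i _.
  by rewrite subr0 sinB; ring.
rewrite -[RHS]mulr1 -(cos2Dsin2 th); ring.
Qed.

Lemma trig_sum_sqr m (p y : 'I_m -> R) x :
  cos_sum p y 0 x ^+ 2 + sin_sum p y 0 x ^+ 2 =
  \sum_(i < m) \sum_(j < m) p i * p j * cos ((y i - y j) * x - 0).
Proof.
rewrite !expr2 /cos_sum /sin_sum !big_distrlr/= -big_split/=;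
  apply: eq_bigr => i _.
rewrite -big_split/=; apply: eq_bigr => j _.
by rewrite !subr0 mulrBl cosB; ring.
Qed.

Lemma measurable_cos_sum m (p y : 'I_m -> R) th :
  measurable_fun setT (cos_sum p y th).
Proof.
apply: measurable_sum => i; apply: measurable_funM => //;
  exact: measurable_cos_affine.
Qed.

Lemma measurable_sin_sum m (p y : 'I_m -> R) th :
  measurable_fun setT (sin_sum p y th).
Proof.
apply: measurable_sum => i; apply: measurable_funM => //;
  exact: measurable_sin_affine.
Qed.

(** Bochner's theorem for this kernel: the quadratic form is an integral of
squared moduli against the positive density [K_0]. *)
Lemma kernel_form_integral m (p y : 'I_m -> R) :
  mu.-integrable setT (EFin \o (fun x =>
    besselK 0 (c * `|x|) * (cos_sum p y 0 x ^+ 2 + sin_sum p y 0 x ^+ 2))) /\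
  kernel_form imq p y =
    \int[mu]_x (besselK 0 (c * `|x|) *
      (cos_sum p y 0 x ^+ 2 + sin_sum p y 0 x ^+ 2)).
Proof.
have iF i j : mu.-integrable setT
  (EFin \o (fun x =>
  p i * p j * (besselK 0 (c * `|x|) * cos ((y i - y j) * x - 0)))).
  apply: integrableZR => //; apply: (@integrable_besselK0_bounded _ _ 1) => //.
    exact: measurable_cos_affine.
  by move=> x; exact: cos_max.
have E x : besselK 0 (c * `|x|) *
  (cos_sum p y 0 x ^+ 2 + sin_sum p y 0 x ^+ 2) =
   \sum_(i < m) \sum_(j < m) p i * p j *
     (besselK 0 (c * `|x|) * cos ((y i - y j) * x - 0)).
  rewrite trig_sum_sqr mulr_sumr; apply: eq_bigr => i _; rewrite mulr_sumr;
    apply: eq_bigr => j _; ring.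
have h i := Rintegral_sum (index_enum 'I_m) (iF i).
have [h1 h2] := Rintegral_sum (index_enum 'I_m) (fun i => (h i).1).
split; first by apply: eq_integrable h1 => // x _ /=; rewrite E.
under [RHS]eq_Rintegral do rewrite E.
rewrite h2; apply: eq_bigr => i _; rewrite (h i).2; apply: eq_bigr => j _.
rewrite RintegralZl//; last first.
  apply: (@integrable_besselK0_bounded _ _ 1) => //;
    first exact: measurable_cos_affine.
  by move=> x; exact: cos_max.
by rewrite integral_besselK0_cos// cos0 mul1r.
Qed.

Lemma kernel_form_ge0 m (p y : 'I_m -> R) : 0 <= kernel_form imq p y.
Proof.
rewrite (kernel_form_integral p y).2; apply: Rintegral_ge0 => x _.
by rewrite mulr_ge0 ?besselK0_ge0// addr_ge0 ?sqr_ge0.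
Qed.

Lemma Rintegral_setD1 (a : R) (f : R -> R) : measurable_fun setT f ->
  \int[mu]_(x in [set: R] `\ a) f x = \int[mu]_x f x.
Proof.
move=> mf; rewrite /Rintegral integral_setD1//; first exact: measurableD.
by apply/measurable_EFinP; exact: measurable_funTS.
Qed.

Section dual_bound.
Variables (g1 g2 W : R -> R) (kap : R).
Hypotheses (mg1 : measurable_fun setT g1) (mg2 : measurable_fun setT g2).
Hypothesis ig : mu.-integrable setT (EFin \o (fun w => `|g1 w| + `|g2 w|)).
Hypothesis iW : mu.-integrable setT
  (EFin \o (fun w => (g1 w ^+ 2 + g2 w ^+ 2) * W w)).
Hypothesis W0 : forall w, 0 < W w.
Hypothesis WK : forall w, w != 0 -> 1 <= W w * besselK 0 (c * `|w|).

Lemma integrable_modulated y th :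
  mu.-integrable setT (EFin \o modulate_re g1 g2 y th).
Proof.
apply: (@integrable_dominated _ setT _ _ _ _ ig) => //;
  first exact: measurable_modulate_re.
by move=> w _; exact: modulate_re_le.
Qed.

(** [2 a b <= W a^2 + K b^2] is integrated, where [W K >= 1] holds away from the
origin only. *)
Lemma native_duality m (p y : 'I_m -> R) th :
  2 * (\sum_(i < m) p i * (kap * \int[mu]_w modulate_re g1 g2 (y i) th w)) <=
  kap ^+ 2 * \int[mu]_w ((g1 w ^+ 2 + g2 w ^+ 2) * W w) + kernel_form imq p y.
Proof.
have iF i : mu.-integrable setT
  (EFin \o (fun w => p i * kap * modulate_re g1 g2 (y i) th w)).
  by apply: integrableZR => //; exact: integrable_modulated.
have [h1 h2] := Rintegral_sum (index_enum 'I_m) iF.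
have -> : \sum_(i < m) p i * (kap * \int[mu]_w modulate_re g1 g2 (y i) th w) =
  \int[mu]_w (\sum_(i < m) p i * kap * modulate_re g1 g2 (y i) th w).
  rewrite h2; apply: eq_bigr => i _; rewrite RintegralZl ?mulrA//;
    exact: integrable_modulated.
have [q1 ->] := kernel_form_integral p y.
have i1 : mu.-integrable setT
  (EFin \o (fun w =>
  2 * (\sum_(i < m) p i * kap * modulate_re g1 g2 (y i) th w))).
  exact: integrableZR.
have i2 : mu.-integrable setT
  (EFin \o (fun w => kap ^+ 2 * ((g1 w ^+ 2 + g2 w ^+ 2) * W w))).
  exact: integrableZR.
have i3 : mu.-integrable setT
  (EFin \o (fun w => kap ^+ 2 * ((g1 w ^+ 2 + g2 w ^+ 2) * W w) +
  besselK 0 (c * `|w|) *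
    (cos_sum p y 0 w ^+ 2 + sin_sum p y 0 w ^+ 2))) by exact: integrableDR.
rewrite -RintegralZl// -[X in _ <= X + _]RintegralZl// -RintegralD//.
have mi (f : R -> R) : mu.-integrable setT (EFin \o f) -> measurable_fun setT f.
  by move=> i; apply/measurable_EFinP; exact: measurable_int i.
(* at the origin [K_0] has a default value, so this point is removed *)
rewrite -(Rintegral_setD1 0 (mi _ i1)) -(Rintegral_setD1 0 (mi _ i3)).
have mD : measurable ([set: R] `\ 0) by exact: measurableD.
apply: le_Rintegral => //; [exact: integrableS i1|exact: integrableS i3|].
move=> w [_ /= /eqP w0].
rewrite -(trig_sum_phase p y th).
have -> : \sum_(i < m) p i * kap * modulate_re g1 g2 (y i) th w =
  kap * (g1 w * cos_sum p y th w - g2 w * sin_sum p y th w).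
  rewrite /cos_sum /sin_sum !mulr_sumr -sumrB mulr_sumr; apply: eq_bigr => i _.
  by rewrite /modulate_re; ring.
have := WK w0; have := W0 w; have := besselK0_ge0 (c * `|w|).
set K := besselK _ _; set V := W w; set C := cos_sum _ _ _ _; set S :=
  sin_sum _ _ _ _.
move=> K0 V0 VK.
have ab (a b : R) : 2 * (a * b) <= a ^+ 2 * V + K * b ^+ 2.
  rewrite -(ler_pM2l V0) -subr_ge0.
  rewrite (_ : _ - _ = (V * a - b) ^+ 2 + (V * K - 1) * b ^+ 2); last by ring.
  by rewrite addr_ge0 ?sqr_ge0// mulr_ge0 ?sqr_ge0// subr_ge0.
have := ab (kap * g1 w) C; have := ab (- kap * g2 w) S; rewrite !exprMn sqrrN;
  lra.
Qed.

End dual_bound.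

(** The squared Lagrange errors of the exponentials are integrated against
[K_0]; their bound is a multiple of [w^(2 N)], whose integral is an even moment.
*)
Lemma power_function_le N (xs : nat -> R) (x r : R) : (0 < N)%N ->
  injective xs ->
  (forall j : 'I_N, `|x - xs j| <= r) ->
  kernel_form imq (cons_ord 1 (fun j => - lagrange_weight xs x j))
    (cons_ord x (fun j : 'I_N => xs j)) <=
  (r ^+ N / N`!%:R) ^+ 2 * (4 * N.*2`!%:R / c ^+ N.*2.+1).
Proof.
move=> N0 xsi hr; have [q1 ->] :=
  kernel_form_integral (cons_ord 1 (fun j => - lagrange_weight xs x j))
  (cons_ord x (fun j : 'I_N => xs j)).
have pow0 (w : R) : 0 <= w ^+ N.*2 by rewrite -mul2n exprM exprn_ge0 ?sqr_ge0.
have mw : measurable_fun setT (fun w : R => besselK 0 (c * `|w|) * w ^+ N.*2).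
  by apply: measurable_funM;
    [exact: measurable_besselK0|by apply: continuous_measurable_fun;
    exact: exprn_continuous].
have iw : mu.-integrable setT
  (EFin \o (fun w => besselK 0 (c * `|w|) * w ^+ N.*2)).
  apply: ge0_integrable => //; first by move=> w;
    rewrite mulr_ge0 ?besselK0_ge0.
  exact: le_lt_trans (integral_besselK0_pow N c0) (ltry _).
set D := (r ^+ N / _) ^+ 2.
have D0 : 0 <= D by exact: sqr_ge0.
apply: (@le_trans _ _ (\int[mu]_w (D * (besselK 0 (c * `|w|) * w ^+ N.*2)))).
  apply: le_Rintegral => //; first exact: integrableZR.
  move=> w _; rewrite mulrCA ler_wpM2l ?besselK0_ge0//.
  have := lagrange_exp_error N0 xsi w hr; rewrite -/D.
  rewrite /cos_sum /sin_sum !big_ord_recl !cons_ord0 !mul1r !subr0.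
  have -> : \sum_(i < N) cons_ord 1 (fun j =>
    - lagrange_weight xs x j) (lift ord0 i) *
     cos (cons_ord x (fun j : 'I_N => xs j) (lift ord0 i) * w - 0) =
       - \sum_(j < N) lagrange_weight xs x j * cos (w * xs j).
    by rewrite -sumrN; apply: eq_bigr => j _;
      rewrite !cons_ord_lift subr0 mulNr [xs j * w]mulrC.
  have -> : \sum_(i < N) cons_ord 1 (fun j =>
    - lagrange_weight xs x j) (lift ord0 i) *
     sin (cons_ord x (fun j : 'I_N => xs j) (lift ord0 i) * w - 0) =
       - \sum_(j < N) lagrange_weight xs x j * sin (w * xs j).
    by rewrite -sumrN; apply: eq_bigr => j _;
      rewrite !cons_ord_lift subr0 mulNr [xs j * w]mulrC.
  by rewrite [x * w]mulrC.
rewrite RintegralZl// ler_wpM2l//.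
rewrite -lee_fin /Rintegral fineK; last by apply: integrable_fin_num.
exact: integral_besselK0_pow.
Qed.

End dual.

(** * Numerical estimates *)

Section numeric.
Variable R : realType.

Lemma fact_double_le n : (n.*2`! <= 4 ^ n * (n`! * n`!))%N.
Proof.
elim: n => [//|n IH].
rewrite doubleS !factS expnS.
apply: (@leq_trans (n.*2.+2 * (n.*2.+2 * (4 ^ n * (n`! * n`!))))).
  by rewrite leq_mul// leq_mul.
by rewrite -doubleS -mul2n; apply/eq_leq; ring.
Qed.

(** By [(2 N)! <= 4^N (N!)^2] and [r <= c / 12], the left-hand side decays like
[(4 / 144)^N]. *)
Lemma power_function_numeric (c r : R) N : 0 < c -> 0 <= r <= c / 12 ->
  (r ^+ N / N`!%:R) ^+ 2 * (4 * N.*2`!%:R / c ^+ N.*2.+1) <= 4 / c / 36 ^+ N.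
Proof.
move=> c0 /andP[r0 rc].
have f0 : 0 < (N`!%:R : R) by rewrite ltr0n fact_gt0.
have h1 : (N.*2`!%:R : R) <= 4 ^+ N * (N`!%:R * N`!%:R).
  by rewrite -natrX -!natrM ler_nat fact_double_le.
have h2 : (r ^+ N) ^+ 2 <= (c ^+ N) ^+ 2 / 144 ^+ N.
  rewrite -!exprM mulnC !exprM -expr_div_n; apply: lerXn2r;
    rewrite ?nnegrE ?sqr_ge0 ?divr_ge0 ?sqr_ge0//.
  have -> : c ^+ 2 / 144 = (c / 12) ^+ 2 by field.
  by rewrite ler_pXn2r ?nnegrE// (le_trans r0).
have cN : 0 < c ^+ N by rewrite exprn_gt0.
have -> : (r ^+ N / N`!%:R) ^+ 2 * (4 * N.*2`!%:R / c ^+ N.*2.+1) =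
  (4 / c) * ((r ^+ N) ^+ 2 * (N.*2`!%:R / (N`!%:R * N`!%:R)) / (c ^+ N) ^+ 2).
  have -> : c ^+ N.*2.+1 = c * (c ^+ N * c ^+ N) by rewrite exprS -addnn exprD.
  by field; rewrite !gt_eqF.
have c4 : 0 <= 4 / c by rewrite divr_ge0// ltW.
rewrite ler_wpM2l// ler_pdivrMr ?exprn_gt0//.
apply: (@le_trans _ _ ((c ^+ N) ^+ 2 / 144 ^+ N * 4 ^+ N)).
  apply: ler_pM => //; first exact: sqr_ge0.
  by rewrite ler_pdivrMr ?mulr_gt0.
have -> : (144 : R) ^+ N = 36 ^+ N * 4 ^+ N by rewrite -exprMn; congr (_ ^+ _);
  ring.
have p36 : (36 : R) ^+ N != 0 by rewrite expf_neq0.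
have p4 : (4 : R) ^+ N != 0 by rewrite expf_neq0.
rewrite le_eqVlt; apply/orP; left; apply/eqP.
move: p36 p4; set a := (36 : R) ^+ N; set b := (4 : R) ^+ N => a0 b0.
by field; rewrite a0 b0.
Qed.

(** Since [(2 / 3)^M >= (2 / 3)^l] and [pi <= 4], it suffices that
[256 l <= 36 * 16^l]. *)
Lemma decay_numeric (M : R) l : 1 <= M <= l%:R ->
  64 * pi * M / 36 ^+ l.+1 <= ((2 / 3) `^ M) ^+ 2.
Proof.
move=> /andP[M1 Ml].
have l0 : (0 < l)%N by rewrite -(ltr_nat R) (lt_le_trans ltr01)// (le_trans M1).
have q1 : (2 / 3) ^+ l <= (2 / 3) `^ M :> R.
  rewrite -powR_mulrn; last by lra.
  by apply: ger_powR => //; lra.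
have q0 : 0 <= (2 / 3) ^+ l :> R by rewrite exprn_ge0//; lra.
apply: (@le_trans _ _ (((2 / 3) ^+ l) ^+ 2)); last first.
  by rewrite ler_pXn2r ?nnegrE// powR_ge0.
have E : ((2 / 3) ^+ l) ^+ 2 * 36 ^+ l.+1 = 36 * 16 ^+ l :> R.
  rewrite [36 ^+ _]exprS mulrCA; congr (_ * _).
  by rewrite -exprM mulnC exprM -exprMn; congr (_ ^+ _); field.
rewrite ler_pdivrMr ?exprn_gt0// E.
have p4 : pi <= 4 :> R by have := @pihalf_lt2 R; lra.
have n16 : 16 * (l%:R : R) <= 16 ^+ l.
  rewrite -natrX -natrM ler_nat; case: l l0 {Ml q1 q0 E} => // l _.
  by rewrite expnS leq_mul2l /= ltn_expl.
have pm : pi * M <= 4 * l%:R by rewrite ler_pM ?pi_ge0// (le_trans ler01).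
lra.
Qed.

Lemma exists_angle (a b : R) : exists th, a * cos th + b * sin th =
  Num.sqrt (a ^+ 2 + b ^+ 2).
Proof.
set n := Num.sqrt _.
have nn : n ^+ 2 = a ^+ 2 + b ^+ 2 by rewrite sqr_sqrtr// addr_ge0 ?sqr_ge0.
have n0 : 0 <= n by exact: sqrtr_ge0.
have [z|nz] := eqVneq n 0.
  exists 0; rewrite cos0 sin0 mulr1 mulr0 addr0 z.
  have : a ^+ 2 <= 0 by have := sqr_ge0 b; rewrite z expr0n/= in nn; lra.
  by rewrite le_eqVlt ltNge sqr_ge0 orbF sqrf_eq0 => /eqP.
have n00 : 0 < n by rewrite lt_neqAle eq_sym nz.
have an : -1 <= a / n <= 1.
  rewrite -ler_norml normrM normfV (gtr0_norm n00) ler_pdivrMr// mul1r.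
  by rewrite -(@ler_pXn2r _ 2) ?nnegrE// real_normK ?num_real//
    nn lerDl sqr_ge0.
have ca : cos (acos (a / n)) = a / n by rewrite acosK// in_itv/=.
have sa : sin (acos (a / n)) = `|b| / n.
  rewrite sin_acos// (_ : 1 - _ = (b / n) ^+ 2).
    by rewrite sqrtr_sqr normrM normfV (gtr0_norm n00).
  have -> : 1 = n ^+ 2 / n ^+ 2 by rewrite divff// expf_neq0.
  by rewrite !expr_div_n -mulrBl nn; congr (_ / _); ring.
have E : a * (a / n) + b * (b / n) = n.
  have -> : a * (a / n) + b * (b / n) = (a ^+ 2 + b ^+ 2) / n by ring.
  by rewrite -nn expr2 mulfK.
have [b0|b0] := leP 0 b.
  by exists (acos (a / n)); rewrite ca sa ger0_norm.
by exists (- acos (a / n)); rewrite cosN sinN ca sa ltr0_norm// mulNr opprK.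
Qed.

End numeric.

(** * The spectral weight and the energies A and B *)

Section spectral.
Variable R : realType.
Notation mu := (@lebesgue_measure R).

(** An upper bound of [1 / K_0 (c |w|)]: the weight that appears in the energies
of the final estimate. *)
Definition spectral_weight (c w : R) : R :=
  if `|w| <= c^-1 then (besselK 0 1)^-1
  else 2 * Num.sqrt 3 * (Num.sqrt (c * `|w|) * expR (c * `|w|)).

Lemma spectral_weight_gt0 (c w : R) : 0 < c -> 0 < spectral_weight c w.
Proof.
move=> c0; rewrite /spectral_weight; case: ifPn => [_|].
  by rewrite invr_gt0 besselK0_gt0.
rewrite -ltNge => cw; have w0 : 0 < `|w| by apply: lt_trans cw;
  rewrite invr_gt0.
rewrite mulr_gt0// ?mulr_gt0 ?expR_gt0// sqrtr_gt0// mulr_gt0//.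
Qed.

(** Monotonicity below [1 / c], the exponential lower bound of [K_0] above it,
together with [2 sqrt 3 >= 3]. *)
Lemma spectral_weight_besselK0 (c w : R) : 0 < c -> w != 0 ->
  1 <= spectral_weight c w * besselK 0 (c * `|w|).
Proof.
move=> c0 w0; have aw : 0 < `|w| by rewrite normr_gt0.
have cw : 0 < c * `|w| by rewrite mulr_gt0.
rewrite /spectral_weight; case: ifPn => [wc|].
  have K1 := @besselK0_gt0 R 1 ltr01.
  rewrite mulrC ler_pdivlMr// mul1r; apply: besselK0_nonincreasing => //.
  by rewrite mulrC -ler_pdivlMr// div1r.
rewrite -ltNge => wc.
have z1 : 1 <= c * `|w| by rewrite mulrC -ler_pdivrMr// div1r ltW.
have h := besselK0_ge_expR z1; move: h z1 cw.
set z := c * `|w| => h z1 z0.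
have s0 : 0 < Num.sqrt z by rewrite sqrtr_gt0.
have s3 : 3 / 2 <= Num.sqrt 3 :> R.
  have h32 : 0 <= 3 / 2 :> R by rewrite divr_ge0.
  by rewrite -(@ler_pXn2r _ 2) ?nnegrE ?sqrtr_ge0// sqr_sqrtr//; lra.
have e0 := expR_gt0 z.
have A0 : 0 < 2 * Num.sqrt 3 * (Num.sqrt z * expR z) by rewrite !mulr_gt0//;
  lra.
apply: le_trans (ler_wpM2l (ltW A0) h).
have -> : 2 * Num.sqrt 3 * (Num.sqrt z * expR z) *
  (expR (- z) / (3 * Num.sqrt z)) = 2 * Num.sqrt 3 / 3.
  by rewrite expRN; field; rewrite !gt_eqF.
lra.
Qed.

Lemma measurable_spectral_weight (c : R) :
  measurable_fun setT (spectral_weight c).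
Proof.
apply: measurable_fun_ifT => //.
  by apply: measurable_fun_ler => //; exact: measurable_cst.
have mcw : measurable_fun setT (fun w : R =>
  c * `|w|) by exact: measurable_funM.
apply: measurable_funM => //; apply: measurable_funM;
  last exact: measurableT_comp.
apply: (@measurableT_comp _ _ _ _ _ _ (@Num.sqrt R)) => //.
by apply: continuous_measurable_fun; exact: sqrt_continuous.
Qed.

Variables (c sigma : R) (q : R -> R).
Hypothesis c0 : 0 < c.
Hypothesis (iq : mu.-integrable setT (EFin \o q)) (q0 : forall w, 0 <= q w).

Let mq : measurable_fun setT q.
Proof. by apply/measurable_EFinP; exact: measurable_int iq. Qed.

(** The quantities [A] and [B] of the estimate, for [q = |fhat|^2]. *)
Definition low_energy :=
  (besselK 0 1)^-1 * \int[mu]_(xi in [set xi : R | `|xi| <= c^-1]) q xi.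
Definition high_energy := if c^-1 < sigma then
      2 * Num.sqrt 3 * \int[mu]_(xi in [set xi : R | c^-1 < `|xi| <= sigma])
        (q xi * Num.sqrt (c * `|xi|) * expR (c * `|xi|))
    else 0.

Let mnorm (a : R) : measurable [set x : R | `|x| <= a].
Proof.
rewrite (_ : mkset _ = `[- a, a]%classic) //.
by apply/seteqP; split => x /=; rewrite in_itv/= ler_norml.
Qed.

Let mshell : measurable [set xi : R | c^-1 < `|xi| <= sigma].
Proof.
rewrite (_ : mkset _ =
  [set x : R | `|x| <= sigma] `\` [set x : R | `|x| <= c^-1]).
  exact: measurableD.
apply/seteqP; split => x /=; first by move=> /andP[h ->]; split => //;
  apply/negP; rewrite -ltNge.
by move=> [-> /negP]; rewrite -ltNge => ->.
Qed.

Let ishell : mu.-integrable [set xi : R | c^-1 < `|xi| <= sigma]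
  (EFin \o (fun xi => q xi * Num.sqrt (c * `|xi|) * expR (c * `|xi|))).
Proof.
pose B := Num.sqrt (c * sigma) * expR (c * sigma).
apply: (@integrable_dominated _ _ _ (fun xi => B * q xi)) => //.
- apply: measurable_funTS; apply: measurable_funM.
    apply: measurable_funM => //;
      apply: (@measurableT_comp _ _ _ _ _ _ (@Num.sqrt R)).
      by apply: continuous_measurable_fun; exact: sqrt_continuous.
    exact: measurable_funM.
  by apply: measurableT_comp => //; exact: measurable_funM.
- apply: integrableZR => //; exact: integrableS iq.
move=> x /= /andP[_ xs].
have h : c * `|x| <= c * sigma by rewrite ler_pM2l.
rewrite ger0_norm ?mulr_ge0 ?expR_ge0 ?sqrtr_ge0// -mulrA mulrC ler_wpM2r//.
by rewrite ler_pM ?sqrtr_ge0 ?expR_ge0// ?ler_expR// ler_wsqrtr.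
Qed.

(** Replacing [fhat] by its cut-off makes it vanish everywhere, not only almost
everywhere, outside the band. *)
Definition cutoff (g : R -> R) (w : R) : R := if `|w| <= sigma then g w else 0.

Lemma integral_spectral_weight_le :
  mu.-integrable setT (EFin \o (fun w => cutoff q w * spectral_weight c w)) /\
  \int[mu]_w (cutoff q w * spectral_weight c w) <= low_energy + high_energy.
Proof.
pose S1 := [set xi : R | `|xi| <= c^-1].
pose S2 := [set xi : R | c^-1 < `|xi| <= sigma].
pose b w := if c^-1 < sigma then
  2 * Num.sqrt 3 * ((fun xi =>
    q xi * Num.sqrt (c * `|xi|) * expR (c * `|xi|)) \_ S2) w else 0.
pose a w := (besselK 0 1)^-1 * (q \_ S1) w.
have ia : mu.-integrable setT (EFin \o a).
  apply: integrableZR => //; rewrite -restrict_EFin.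
  apply: (iffLR (@integrable_mkcond _ _ _ mu S1 (EFin \o q) _));
    first exact: mnorm.
  by apply: integrableS iq => //; exact: mnorm.
have ib : mu.-integrable setT (EFin \o b).
  rewrite /b; have [_|_] := ltP c^-1 sigma; last first.
    by apply: (@eq_integrable _ _ _ mu _ _ (cst 0%E)) => //; exact: integrable0.
  apply: integrableZR => //; rewrite -restrict_EFin.
  by apply: (iffLR (@integrable_mkcond _ _ _ mu S2 _ _)).
have ab w : 0 <= cutoff q w * spectral_weight c w <= a w + b w.
  have W0 := spectral_weight_gt0 w c0.
  have a0 : 0 <= a w.
    rewrite mulr_ge0 ?invr_ge0 ?besselK0_ge0// patchE; case: ifP => _ //.
  have b0 : 0 <= b w.
    rewrite /b; case: ifP => _ //;
      rewrite mulr_ge0 ?mulr_ge0 ?sqrtr_ge0// patchE; case: ifP => _ //.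
    by rewrite !mulr_ge0 ?sqrtr_ge0 ?expR_ge0.
  rewrite /cutoff; case: ifPn => ws; last by rewrite mul0r lexx addr_ge0.
  rewrite mulr_ge0 ?(ltW W0)//=.
  rewrite /spectral_weight; case: ifPn => wc.
    by rewrite mulrC /a patchE mem_set// lerDl.
  rewrite -ltNge in wc.
  have wS2 : w \in S2 by rewrite inE /S2 /= wc ws.
  rewrite /b (lt_le_trans wc ws) patchE wS2.
  rewrite (_ : q w * _ =
    2 * Num.sqrt 3 * (q w * Num.sqrt (c * `|w|) * expR (c * `|w|))) ?lerDr//.
  by ring.
have iab : mu.-integrable setT (EFin \o (fun w => a w + b w)) by exact:
  integrableDR.
have mc : measurable_fun setT (fun w => cutoff q w * spectral_weight c w).
  apply: measurable_funM; last exact: measurable_spectral_weight.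
  by apply: measurable_fun_ifT => //; apply: measurable_fun_ler => //;
    exact: measurable_cst.
have ic : mu.-integrable setT
  (EFin \o (fun w => cutoff q w * spectral_weight c w)).
  apply: (@integrable_dominated _ _ _ (fun w => a w + b w)) => // w _.
  by have /andP[h1 h2] := ab w; rewrite ger0_norm.
split => //; apply: (@le_trans _ _ (\int[mu]_w (a w + b w))).
  by apply: le_Rintegral => // w _; have /andP[] := ab w.
rewrite RintegralD//; apply: lerD.
  rewrite /a RintegralZl//; last first.
    rewrite -restrict_EFin.
    apply: (iffLR (@integrable_mkcond _ _ _ mu S1 (EFin \o q) _));
      first exact: mnorm.
    by apply: integrableS iq => //; exact: mnorm.
  by rewrite /low_energy [in leRHS]Rintegral_mkcond.
rewrite /b /high_energy; have [_|_] := ltP c^-1 sigma;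
  last by rewrite Rintegral_cst// mul0r.
rewrite RintegralZl//; last first.
  by rewrite -restrict_EFin;
    apply: (iffLR (@integrable_mkcond _ _ _ mu S2 _ _)).
by rewrite [in leRHS]Rintegral_mkcond.
Qed.

End spectral.

(** * Real and imaginary parts, and the error estimate *)

Section bridge.
Variable R : realType.
Notation mu := (@lebesgue_measure R).

Lemma sqr_normcE (z : R[i]) : normc z ^+ 2 =
  complex.Re z ^+ 2 + complex.Im z ^+ 2.
Proof. by case: z => a b; rewrite /normc/= sqr_sqrtr// addr_ge0 ?sqr_ge0. Qed.

Lemma normcR_ge0 (z : R[i]) : 0 <= normc z.
Proof. by case: z => a b; exact: sqrtr_ge0. Qed.

Lemma continuous_Re (f : R -> R[i]) : continuous (f : R -> R[i]^o) ->
  continuous (fun x => complex.Re (f x)).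
Proof.
move=> cf x; apply/cvgrPdist_le => e e0.
have e0c : 0 < (e%:C)%C :> R[i] by rewrite (ltcR 0 e).
have /cvgrPdist_le /(_ _ e0c) := cf x.
apply: filterS => t; rewrite /= normc_def lecR; apply: le_trans.
rewrite -sqrtr_sqr ler_wsqrtr//; case: (f x) => a b; case: (f t) => a' b' /=.
by rewrite lerDl sqr_ge0.
Qed.

Lemma continuous_Im (f : R -> R[i]) : continuous (f : R -> R[i]^o) ->
  continuous (fun x => complex.Im (f x)).
Proof.
move=> cf x; apply/cvgrPdist_le => e e0.
have e0c : 0 < (e%:C)%C :> R[i] by rewrite (ltcR 0 e).
have /cvgrPdist_le /(_ _ e0c) := cf x.
apply: filterS => t; rewrite /= normc_def lecR; apply: le_trans.
rewrite -sqrtr_sqr ler_wsqrtr//; case: (f x) => a b; case: (f t) => a' b' /=.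
by rewrite lerDr sqr_ge0.
Qed.

Lemma Re_truncated_fourier T (f : R -> R[i]) w :
  complex.Re (truncated_fourier T f w) =
  trunc_re (fun x => complex.Re (f x)) (fun x => complex.Im (f x)) T w.
Proof.
rewrite /truncated_fourier /trunc_re /cintegral /= mul0r subr0; congr (_ * _).
apply: eq_Rintegral => x _; case: (f x) => a b /=.
by rewrite cosN sinN; ring.
Qed.

Lemma Im_truncated_fourier T (f : R -> R[i]) w :
  complex.Im (truncated_fourier T f w) =
  trunc_im (fun x => complex.Re (f x)) (fun x => complex.Im (f x)) T w.
Proof.
rewrite /truncated_fourier /trunc_im /cintegral /= mul0r addr0; congr (_ * _).
apply: eq_Rintegral => x _; case: (f x) => a b /=.
by rewrite cosN sinN; ring.
Qed.

Lemma is_fourier_trunc_sqdist (f g : R -> R[i]) : is_fourier f g ->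
  forall e, 0 < e -> exists T0, forall T, T0 <= T ->
    (\int[mu]_w (trunc_sqdist (fun x => complex.Re (f x)) (fun x =>
      complex.Im (f x))
      (fun x => complex.Re (g x)) (fun x => complex.Im (g x)) T w)%:E < e%:E)%E.
Proof.
move=> [_ _ cv] e e0.
have e0' : (0 < e%:E)%E by rewrite lte_fin.
have [M [_ hM]] := cv _ (open_ereal_lt' e0').
exists (M + 1) => T hT.
have := hM T; rewrite /= /sqnormL2.
have -> : (\int[mu]_x (normc (g x - truncated_fourier T f x) ^+ 2)%:E =
  \int[mu]_w (trunc_sqdist (fun x => complex.Re (f x)) (fun x =>
    complex.Im (f x))
      (fun x => complex.Re (g x)) (fun x => complex.Im (g x)) T w)%:E)%E.
  apply: eq_integral => w _;
    rewrite sqr_normcE /trunc_sqdist -Re_truncated_fourier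
    -Im_truncated_fourier.
  by case: (g w) => a b; case: (truncated_fourier T f w).
by apply; apply: lt_le_trans hT; rewrite ltrDl.
Qed.

(** The cut-off of one representative is again a transform of [f]: inside the
band it is that representative, outside the band it agrees almost everywhere
with one that vanishes there, and the two squared distances add up. *)
Lemma cutoff_trunc_sqdist (f g gh : R -> R[i]) sigma :
  continuous (f : R -> R[i]^o) ->
  is_fourier f g -> is_fourier f gh ->
  {ae mu, forall xi, sigma < `|xi| -> g xi = 0} ->
  forall e, 0 < e -> exists T0, forall T, T0 <= T ->
    (\int[mu]_w (trunc_sqdist (fun x => complex.Re (f x)) (fun x =>
      complex.Im (f x))
      (cutoff sigma (fun x => complex.Re (gh x)))
        (cutoff sigma (fun x => complex.Im (gh x))) T w)%:E < e%:E)%E.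
Proof.
move=> cf fg fgh gs e e0.
have cf1 := continuous_Re cf; have cf2 := continuous_Im cf.
have e20 : 0 < e / 2 by rewrite divr_gt0.
have [T1 h1] := is_fourier_trunc_sqdist fg e20.
have [T2 h2] := is_fourier_trunc_sqdist fgh e20.
exists (Num.max T1 T2) => T; rewrite ge_max => /andP[t1 t2].
have {h1} := h1 T t1; have {h2} := h2 T t2.
move: fg fgh => [_ [[mg1 mg2] _] _] [_ [[mh1 mh2] _] _] h2 h1.
have mcut (a : R -> R) : measurable_fun setT a ->
  measurable_fun setT (cutoff sigma a).
  move=> ma; apply: measurable_fun_ifT => //.
  by apply: measurable_fun_ler => //; exact: measurable_cst.
have md (a b : R -> R) : measurable_fun setT a -> measurable_fun setT b ->
  measurable_fun setT (fun w =>
    (trunc_sqdist (fun x => complex.Re (f x)) (fun x =>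
    complex.Im (f x)) a b T w)%:E).
  by move=> ma mb; apply/measurable_EFinP; exact: measurable_trunc_sqdist.
have d0 (a b : R -> R) w :
  (0 <= (trunc_sqdist (fun x => complex.Re (f x)) (fun x =>
  complex.Im (f x)) a b T w)%:E)%E.
  by rewrite lee_fin trunc_sqdist_ge0.
have -> : e = e / 2 + e / 2 by field.
rewrite EFinD; apply: le_lt_trans (lteD h2 h1).
rewrite -ge0_integralD//; last 2 first.
- exact: md.
- exact: md.
apply: ae_ge0_le_integral => //.
- by apply: md; exact: mcut.
- by move=> w _; rewrite adde_ge0.
- by apply: emeasurable_funD; exact: md.
case: gs => N [mN N0 sN]; exists N; split => // w /= hw; apply: sN => /= hN;
  apply: hw => _.
rewrite -EFinD lee_fin.
have d0' (a b : R -> R) : 0 <=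
  trunc_sqdist (fun x => complex.Re (f x)) (fun x => complex.Im (f x)) a b T w.
  exact: trunc_sqdist_ge0.
have [ws|ws] := leP `|w| sigma.
  by rewrite {1}/trunc_sqdist /cutoff ws lerDl.
have gw := hN ws.
have nws : (`|w| <= sigma) = false by rewrite leNgt ws.
rewrite {1}/trunc_sqdist /cutoff nws -[leLHS]add0r lerD//.
by rewrite /trunc_sqdist gw.
Qed.

Lemma Re_sum (I : Type) (r : seq I) (F : I -> R[i]) :
  complex.Re (\sum_(i <- r) F i) = \sum_(i <- r) complex.Re (F i).
Proof. by apply: (big_morph (@complex.Re R)) => //; case=> a b [a' b']. Qed.

Lemma Im_sum (I : Type) (r : seq I) (F : I -> R[i]) :
  complex.Im (\sum_(i <- r) F i) = \sum_(i <- r) complex.Im (F i).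
Proof. by apply: (big_morph (@complex.Im R)) => //; case=> a b [a' b']. Qed.

(** A constant factor of the kernel is absorbed by the coefficients of an
interpolant. *)
Lemma multiquadricE (c y : R) :
  multiquadric (-1) c y = Gamma (- (-1) / 2 : R) / pi * imq c y.
Proof.
rewrite /multiquadric /imq real_normK ?num_real// -mulrA; congr (_ * _).
have p0 : pi != 0 :> R by rewrite gt_eqF// pi_gt0.
by rewrite mulKf// mulN1r powRN powR12_sqrt// addr_ge0 ?sqr_ge0.
Qed.

Lemma unit_ball_volume1E : unit_ball_volume1 R = 2.
Proof.
rewrite /unit_ball_volume1 (_ : mkset _ = `[-1, 1]%classic); last first.
  by apply/seteqP; split => x /=; rewrite in_itv/= ler_norml.
rewrite lebesgue_measure_itv/= lte_fin ifT; last by lra.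
by rewrite /=; ring.
Qed.

Lemma integrable_sqnorm (g : R -> R[i]) : inL2 g ->
  mu.-integrable setT (EFin \o (fun w => normc (g w) ^+ 2)).
Proof.
move=> [[m1 m2] g2]; apply: ge0_integrable => //; last by move=> w;
  exact: sqr_ge0.
under eq_fun do rewrite sqr_normcE !expr2.
by apply: measurable_funD; exact: measurable_funM.
Qed.

Lemma sqr_powR (a x : R) : (a `^ x) ^+ 2 = a `^ (x * 2).
Proof. by rewrite -powR_mulrn ?powR_ge0// powRrM. Qed.

(** The phase [th] is chosen so that the rotated error is real and nonnegative.
Real interpolation then applies to the real part of the rotated function. *)
Lemma interpolation_error (c sigma r : R) (f fhat s : R ->
  R[i]) (l : nat) (xs : nat -> R) (x : R) :
  0 < c -> 0 < sigma -> bandlimited sigma f -> is_fourier f fhat ->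
  0 <= r <= c / 12 -> injective xs -> (forall j : 'I_l.+1, `|x - xs j| <= r) ->
  is_interpolant (multiquadric (-1) c) (fun j : 'I_l.+1 => xs j) f s ->
  normc (f x - s x) ^+ 2 <=
  (2 * pi)^-1 * (low_energy c (fun w => normc (fhat w) ^+ 2) +
    high_energy c sigma (fun w => normc (fhat w) ^+ 2)) *
  (4 / c / 36 ^+ l.+1).
Proof.
move=> c0 s0 [cf [g fg gs]] ffh rc xsi hr [a sE si].
have cf1 := continuous_Re cf; have cf2 := continuous_Im cf.
set q := fun w => normc (fhat w) ^+ 2.
pose f1 y := complex.Re (f y); pose f2 y := complex.Im (f y).
pose h1 y := complex.Re (fhat y); pose h2 y := complex.Im (fhat y).
pose g1 := cutoff sigma h1; pose g2 := cutoff sigma h2.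
have [fL2 hL2 _] := ffh.
have iq := integrable_sqnorm hL2.
have [iW We] := @integral_spectral_weight_le R c sigma q c0 iq (fun w =>
  sqr_ge0 _).
have [[mh1 mh2] _] := hL2.
have mcut (b : R -> R) : measurable_fun setT b ->
  measurable_fun setT (cutoff sigma b).
  move=> mb; apply: measurable_fun_ifT => //.
  by apply: measurable_fun_ler => //; exact: measurable_cst.
have mg1 : measurable_fun setT g1 by exact: mcut.
have mg2 : measurable_fun setT g2 by exact: mcut.
have gsupp w : sigma < `|w| -> g1 w = 0 /\ g2 w = 0.
  by move=> ws; rewrite /g1 /g2 /cutoff leNgt ws.
have gq w : g1 w ^+ 2 + g2 w ^+ 2 = cutoff sigma q w.
  rewrite /g1 /g2 /cutoff; case: ifP => _; last by rewrite expr0n addr0.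
  by rewrite /q sqr_normcE.
have gL2 : (\int[mu]_w (g1 w ^+ 2 + g2 w ^+ 2)%:E < +oo)%E.
  have := hL2.2; apply: le_lt_trans; apply: ge0_le_integral => //.
  - by move=> w _; rewrite lee_fin addr_ge0 ?sqr_ge0.
  - by apply/measurable_EFinP; under eq_fun do rewrite !expr2;
      apply: measurable_funD; exact: measurable_funM.
  - exact: measurable_int iq.
  - move=> w _; rewrite lee_fin gq /cutoff; case: ifP => _ //; exact: sqr_ge0.
have fL2' : (\int[mu]_w (f1 w ^+ 2 + f2 w ^+ 2)%:E < +oo)%E.
  by have := fL2.2; rewrite /sqnormL2; under eq_integral do rewrite sqr_normcE.
have inv := fourier_inversion cf1 cf2 mg1 mg2 (ltW s0) gsupp fL2' gL2
  (cutoff_trunc_sqdist cf fg ffh gs).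
have [th thE] := exists_angle (complex.Re (f x - s x)) (complex.Im (f x - s x)).
pose u y := f1 y * cos th + f2 y * sin th.
pose S y := complex.Re (s y) * cos th + complex.Im (s y) * sin th.
pose N0 := (2 * pi)^-1 * \int[mu]_w (cutoff sigma q w * spectral_weight c w).
have iW' : mu.-integrable setT
  (EFin \o (fun w => (g1 w ^+ 2 + g2 w ^+ 2) * spectral_weight c w)).
  by apply: eq_integrable iW => // w _ /=; rewrite gq.
have dual m (p y : 'I_m -> R) : 2 * (\sum_(i < m) p i * u (y i)) <=
  N0 + kernel_form (imq c) p y.
  have := native_duality c0 (Num.sqrt (2 * pi))^-1 mg1 mg2
    (integrable_gabs mg1 mg2 gsupp gL2) iW'
    (fun w => spectral_weight_gt0 w c0) (fun w =>
      @spectral_weight_besselK0 R c w c0) p y th.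
  rewrite /u; under eq_bigr do rewrite -inv.
  rewrite exprVn sqr_sqrtr ?mulr_ge0 ?pi_ge0//.
  by under eq_Rintegral do rewrite gq.
have ksym y : imq c (- y) = imq c y by rewrite /imq sqrrN.
pose Gm := Gamma (- (-1) / 2 : R) / pi.
have SE z : S z = \sum_(j <
  l.+1) ((complex.Re (a j) * cos th + complex.Im (a j) * sin th) * Gm) *
  imq c (z - xs j).
  rewrite /S sE Re_sum Im_sum !mulr_suml -big_split/=; apply: eq_bigr => j _.
  rewrite multiquadricE -/Gm; case: (a j) => p1 p2 /=; ring.
have Su (j : 'I_l.+1) : S (xs j) = u (xs j) by rewrite /S /u si.
have err := native_interpolation_error ksym (fun m p y =>
  kernel_form_ge0 c0 p y) dual (fun j => lagrange_weight xs x j) x SE Su.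
have pb := power_function_le c0 (ltn0Sn l) xsi hr.
have pn := power_function_numeric l.+1 c0 rc.
have -> : normc (f x - s x) ^+ 2 = (u x - S x) ^+ 2.
  have -> : u x - S x =
    complex.Re (f x - s x) * cos th + complex.Im (f x - s x) * sin th.
    by rewrite /u /S /f1 /f2; case: (f x) => p1 p2; case: (s x) => p3 p4 /=;
      ring.
  by rewrite thE sqr_sqrtr ?addr_ge0 ?sqr_ge0// sqr_normcE.
apply: (le_trans err).
have N00 : 0 <= N0.
  rewrite mulr_ge0 ?invr_ge0 ?mulr_ge0 ?pi_ge0//; apply: Rintegral_ge0 => w _.
  by rewrite -gq mulr_ge0 ?addr_ge0 ?sqr_ge0// ltW// spectral_weight_gt0.
apply: ler_pM => //; first exact: kernel_form_ge0.
  by rewrite /N0 ler_wpM2l// invr_ge0 mulr_ge0// pi_ge0.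
exact: le_trans pb pn.
Qed.

End bridge.

Theorem corollary1p9 (R : realType) (c b0 sigma : R)
    (f fhat s : R -> R[i]) (v1 v2 delta : R) (l : nat) :
  let n : R := 1 in
  let beta : R := -1 in
  let rho : R := 1 in
  let Delta0 : R := 1 in
  let alpha_n : R := unit_ball_volume1 R in
  let C : R := Num.max (2 / (3 * b0)) (8 * rho / c) in
  let delta0 : R := (3 * C)^-1 in
  let lambda' : R := (2 / 3) `^ ((3 * C)^-1) in
  let r : R := `|v1 - v2| in
  let A : R := (besselK 0 1)^-1 *
    \int[lebesgue_measure]_(xi in [set xi : R | `|xi| <= c^-1])
      (normc (fhat xi)) ^+ 2 in
  let B : R :=
    if c^-1 < sigma then
      2 * Num.sqrt 3 *
      \int[lebesgue_measure]_(xi in [set xi : R | c^-1 < `|xi| <= sigma])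
        ((normc (fhat xi)) ^+ 2 * Num.sqrt (c * `|xi|) * expR (c * `|xi|))
    else 0 in
  0 < c -> 0 < b0 -> 0 < sigma ->
  bandlimited sigma f -> is_fourier f fhat ->
  (3 * C)^-1 <= r <= 2 / (3 * C) ->
  0 < delta <= delta0 ->
  (3 * C * delta)^-1 <= l%:R <= 2 / (3 * C * delta) ->
  is_interpolant (multiquadric beta c) (@evenly_spaced R v1 v2 l) f s ->
  forall x, segment v1 v2 x ->
    normc (f x - s x) <=
      2 `^ (- 2 + (- 3 * n + beta) / 4) * pi `^ ((- 3 * n - 1) / 4) *
      Num.sqrt (n * alpha_n) * Num.sqrt Delta0 * Num.sqrt (3 * C) *
      c `^ (beta / 2) * Num.sqrt delta * lambda' `^ (delta^-1) *
      Num.sqrt (A + B).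
Proof.
move=> n beta rho Delta0 alpha_n C delta0 lambda' r A B c0 _ s0 bf ff hr hd hl
  hi x [t].
rewrite /= in_itv/= => /andP[t0 t1] xE.
have Cc : 8 / c <= C by rewrite /C /rho mulr1 le_max lexx orbT.
have C0 : 0 < C by rewrite (lt_le_trans _ Cc)// divr_gt0.
have C30 : 0 < 3 * C by rewrite mulr_gt0.
move: hr hd hl => /andP[r1 r2] /andP[d0 d1] /andP[l1 _].
pose M := (3 * C * delta)^-1.
have M0 : 0 < M by rewrite invr_gt0 mulr_gt0.
have M1 : 1 <= M.
  rewrite /M invf_ge1 ?mulr_gt0// mulrC -ler_pdivlMr// div1r; exact: d1.
have r0 : 0 < r by apply: lt_le_trans r1; rewrite invr_gt0.
have v12 : v1 - v2 != 0 by rewrite -normr_gt0.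
(* [r <= 2 / (3 C)] and [C >= 8 / c] *)
have rc : r <= c / 12.
  apply: (le_trans r2); rewrite ler_pdivrMr//.
  have : c * (8 / c) <= c * C by rewrite ler_pM2l.
  by rewrite mulrCA divff ?gt_eqF// mulr1; lra.
have l0 : 0 < (l%:R : R) by rewrite (lt_le_trans M0).
pose xs (k : nat) : R := k%:R / l%:R * v1 + (l%:R - k%:R) / l%:R * v2.
have xsE k : xs k = v2 + k%:R / l%:R * (v1 - v2) by rewrite /xs; field;
  rewrite gt_eqF.
have xsi : injective xs.
  move=> i j; rewrite !xsE => /addrI /(mulIf v12) /(mulIf _).
  by rewrite invr_eq0 gt_eqF// => /(_ isT) /eqP; rewrite eqr_nat => /eqP.
have hx (j : 'I_l.+1) : `|x - xs j| <= r.
  have -> : x - xs j = (t - j%:R / l%:R) * (v1 - v2) by rewrite xsE -xE; ring.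
  rewrite normrM ler_piMl//.
  have j0 : 0 <= (j%:R : R) / l%:R by rewrite divr_ge0.
  have j1 : (j%:R : R) / l%:R <= 1 by rewrite ler_pdivrMr// mul1r ler_nat -ltnS.
  by rewrite ler_norml; apply/andP; split; lra.
have rr : 0 <= r <= c / 12 by rewrite (ltW r0).
have err := interpolation_error c0 s0 bf ff rr xsi hx hi.
have AB0 : 0 <= A + B.
  apply: addr_ge0.
    by rewrite mulr_ge0 ?invr_ge0 ?besselK0_ge0//; apply: Rintegral_ge0 => w _;
      exact: sqr_ge0.
  rewrite /B; case: ifP => _ //; rewrite mulr_ge0 ?mulr_ge0 ?sqrtr_ge0//.
  by apply: Rintegral_ge0 => w _;
    rewrite !mulr_ge0 ?sqr_ge0 ?sqrtr_ge0 ?expR_ge0 ?normcR_ge0.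
set D := 2 `^ _ * _ * _ * _ * _ * _ * _ * _.
have D0 : 0 <= D by rewrite /D !mulr_ge0 ?powR_ge0 ?sqrtr_ge0.
have DS0 : 0 <= D * Num.sqrt (A + B) by apply: mulr_ge0 => //; exact: sqrtr_ge0.
rewrite -(@ler_pXn2r _ 2) ?nnegrE ?normcR_ge0 ?DS0//.
rewrite exprMn (sqr_sqrtr AB0); apply: (le_trans err).
rewrite -/(low_energy _ _) -/(high_energy _ _ _) mulrAC ler_wpM2r//.
have dn := decay_numeric (M := M) (l := l); rewrite M1 l1 in dn; have {}dn :=
  dn isT.
have pi0 : 0 < pi :> R by exact: pi_gt0.
(* the powers of [2] and [pi] have exponents [-3] and [-1]; [3 C delta = 1 / M]
   *)
have -> : D ^+ 2 = (32 * pi ^+ 2 * c * M)^-1 * ((2 / 3) `^ M) ^+ 2.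
  rewrite /D !exprMn !sqr_powR /n /beta /Delta0 /alpha_n unit_ball_volume1E
    mul1r.
  rewrite !sqr_sqrtr ?(ltW C30) ?(ltW d0)//.
  have -> : (- 2 + (- 3 * 1 + -1) / 4) * 2 = - 6%:R :> R by field.
  have -> : ((- 3 * 1 - 1) / 4) * 2 = - 2%:R :> R by field.
  have -> : (-1 / 2) * 2 = -1 :> R by field.
  rewrite !powR_invn ?pi_ge0// powR_inv1 ?(ltW c0)//.
  have -> : lambda' `^ (delta^-1 * 2) = (2 / 3) `^ (M * 2).
    by rewrite /lambda' -powRrM /M; congr (_ `^ _); rewrite [in RHS]invfM; ring.
  have aux (p k e P : R) : 0 < p -> 0 < k -> 0 < e ->
    2 ^- 6 / p ^+ 2 * 2 * 1 * (3 * k) / c * e * P =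
      (32 * p ^+ 2 * c * (3 * k * e)^-1)^-1 * P.
    by move=> p0 k0 e0; field; rewrite !gt_eqF.
  exact: aux.
have k0 : 0 < 32 * pi ^+ 2 * c * M by rewrite !mulr_gt0// exprn_gt0.
rewrite mulrC -(ler_pM2l k0) mulVKf ?gt_eqF//.
apply: le_trans dn; rewrite le_eqVlt; apply/orP; left; apply/eqP.
have p36 : (36 : R) ^+ l.+1 != 0 by rewrite expf_neq0.
have aux (p m z : R) : p != 0 -> z != 0 ->
  32 * p ^+ 2 * c * m * (4 / c / z / (2 * p)) = 64 * p * m / z.
  by move=> p0 z0; field; rewrite p0 z0 gt_eqF.
by rewrite aux// gt_eqF.
Qed.
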